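(* Let $\beta>0$ and let $P=[p_{i,j}]$ be the transition matrix of any irreducible and aperiodic $M$-state Markov chain, with entropy rate $H$. Then the type-II error exponent $\eta$ for testing $\mathcal{H}_0$ against $\mathcal{H}_1$ (as defined in the context) satisfies $$\eta\ge\begin{cases}0,&\text{if }\beta\le\sqrt{2H},\\ \chi(\beta),&\text{if }\beta\ge\sqrt{2H},\end{cases}$$ where $\chi(\beta)$ is a function that can be parametrized for $t\in(0,1]$ as $$\beta_t=\frac{\sqrt2}{t}\sqrt{\log\lambda_t-t\rho_t},\qquad \chi(\beta_t)=\frac{1-2t}{t^2}\log\lambda_t-\frac{1-t}{t}\rho_t,$$ with $\rho_t=\frac{d}{dt}\log\lambda_t=\dfrac{a_t^T[(\log P)\circ P^{(t)}]b_t}{a_t^TP^{(t)}b_t}$.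
   Context: $P^{(t)}$ is the matrix with entries $p_{i,j}^t$ if $p_{i,j}\ne0$ and $0$ otherwise; $\lambda_t=\lambda_{\max}(P^{(t)})$ is its Perron-Frobenius eigenvalue and $a_t,b_t$ its left and right Perron-Frobenius eigenvectors; $\circ$ is the entrywise product and $[\log P]_{i,j}=\log p_{i,j}$ if $p_{i,j}\ne0$ and $0$ otherwise. Let $\pi$ be the unique stationary distribution of $P$; the entropy rate is $H=-\sum_i\pi_i\sum_jp_{i,j}\log p_{i,j}$. For $s=(s_1,\dots,s_N)\in\{1,\dots,M\}^N$ let $P(s)=\pi_{s_1}p_{s_1,s_2}\cdots p_{s_{N-1},s_N}$. The data are $Y^N=[y_{m,n}]$, $1\le m\le M$, $1\le n\le N$. Under $\mathcal{H}_0$ the $y_{m,n}$ are i.i.d. $\mathcal{N}(0,1)$. Under $\mathcal{H}_1$ a path $s$ is drawn with probability $P(s)$ and, given $s$, the $y_{m,n}$ are independent with law $\mathcal{N}(\beta,1)$ if $m=s_n$ and $\mathcal{N}(0,1)$ if $m\ne s_n$. Fix $\epsilon\in(0,1)$ and let $\delta_N$ be the optimal (Neyman-Pearson, likelihood-ratio threshold) detector based on $Y^N$, i.e. the one minimizing the probability $P_{\mathrm{miss}}$ of deciding $\mathcal{H}_0$ under $\mathcal{H}_1$ subject to the probability of deciding $\mathcal{H}_1$ under $\mathcal{H}_0$ being at most $\epsilon$. The error exponent is $\eta=-\lim_{N\to\infty}\frac1N\log P_{\mathrm{miss}}(\delta_N)$; the limit exists, does not depend on $\epsilon$, and equals the Kullback-Leibler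 divergence rate $-\lim_{N\to\infty}\frac1N\mathbb{E}_0\log\frac{P_1(Y^N)}{P_0(Y^N)}$, where $\mathbb{E}_0$ is expectation under $\mathcal{H}_0$ and $P_0,P_1$ are the densities of $Y^N$ under the two hypotheses. *)

(* Defs.v *)
From HB Require Import structures.
From mathcomp Require Import all_boot all_order all_algebra.
From mathcomp Require Import complex.
From mathcomp Require Import all_classical all_reals all_analysis.

Set Implicit Arguments.
Unset Strict Implicit.
Unset Printing Implicit Defensive.

Import Order.TTheory GRing.Theory Num.Theory.
Import numFieldNormedType.Exports.

Local Open Scope classical_set_scope.
Local Open Scope ring_scope.

Section MarkovChain.
Context {R : realType} {M : nat}.
Implicit Types (P : 'M[R]_M) (pi : 'rV[R]_M).

Definition stochastic P : Prop :=
  (forall i j, 0 <= P i j) /\ (forall i, \sum_j P i j = 1).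

Definition irreducible_chain P : Prop :=
  forall i j, exists k : nat, 0 < (P ^+ k) i j.

(* The gcd of the return times of every state is 1. *)
Definition aperiodic_chain P : Prop :=
  forall (i : 'I_M) (d : nat),
    (forall k : nat, (0 < k)%N -> 0 < (P ^+ k) i i -> (d %| k)%N) -> d = 1%N.

Definition stationary_distribution P pi : Prop :=
  [/\ forall i, 0 <= pi 0 i, \sum_i pi 0 i = 1 & pi *m P = pi].

(* [ln 0 = 0], so impossible transitions contribute 0. *)
Definition entropy_rate P pi : R :=
  - \sum_i pi 0 i * \sum_j P i j * ln (P i j).

Definition path_prob P pi (N : nat) (s : {ffun 'I_N.+1 -> 'I_M}) : R :=
  pi 0 (s ord0) *
  \prod_(n < N) P (s (widen_ord (leqnSn N) n)) (s (lift ord0 n)).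

End MarkovChain.

Section PerronFrobenius.
Context {R : realType} {M : nat}.
Implicit Types (A P : 'M[R]_M) (t : R).

(* A real eigenvalue that dominates every complex eigenvalue in modulus. *)
Definition is_perron_root A (r : R) : Prop :=
  eigenvalue A r /\
  forall z : R[i], eigenvalue (map_mx (real_complex R) A) z ->
    `|z| <= real_complex R r.

(* Such an eigenvalue is unique; it exists for every nonnegative matrix of
   positive size, and 0 is a dummy value otherwise. *)
Definition lambda_max A : R := xget 0 [set r | is_perron_root A r].

Definition left_perron_vector A (a : 'cV[R]_M) : Prop :=
  (forall i, 0 < a i 0) /\ a^T *m A = lambda_max A *: a^T.

Definition right_perron_vector A (b : 'cV[R]_M) : Prop :=
  (forall i, 0 < b i 0) /\ A *m b = lambda_max A *: b.

Definition tilted P t : 'M[R]_M :=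
  \matrix_(i, j) (if P i j == 0 then 0 else P i j `^ t).

Definition log_mx P : 'M[R]_M :=
  \matrix_(i, j) (if P i j == 0 then 0 else ln (P i j)).

Definition log_lambda P t : R := ln (lambda_max (tilted P t)).

Definition rho P t : R := derive1 (log_lambda P) t.

Definition beta_param P t : R :=
  Num.sqrt 2 / t * Num.sqrt (log_lambda P t - t * rho P t).

Definition chi_param P t : R :=
  (1 - 2 * t) / t ^+ 2 * log_lambda P t - (1 - t) / t * rho P t.

End PerronFrobenius.

Section ProductLaw.
Context {d} {T : measurableType d} {R : realType}.

Definition cons_pair n (x : T * n.-tuple T) : n.+1.-tuple T :=
  [the n.+1.-tuple T of x.1 :: x.2].

Lemma measurable_cons_pair n : measurable_fun [set: T * n.-tuple T] (@cons_pair n).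
Proof. exact: measurable_cons. Qed.

HB.instance Definition _ n :=
  isMeasurableFun.Build _ _ _ _ (@cons_pair n) (@measurable_cons_pair n).

(* The law of a tuple with independent coordinates of laws [mu i]. *)
Fixpoint tuple_law n : ('I_n -> probability T R) -> probability (n.-tuple T) R :=
  match n with
  | 0 => fun=> \d_([tuple] : 0.-tuple T)
  | n'.+1 => fun mu =>
      distribution (mu ord0 \x tuple_law (fun i => mu (lift ord0 i)))%E
        (@cons_pair n')
  end.

End ProductLaw.

Section Detection.
Context {R : realType} {M : nat}.
Implicit Types (P : 'M[R]_M) (pi : 'rV[R]_M) (beta eps eta : R) (N : nat).

(* Observations are tuples of columns: [tnth (tnth y n) m] is y_{m,n}. *)
Local Notation observation N := (N.-tuple (M.-tuple (measurableTypeR R))).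

(* Independent entries, y_{m,n} having law N(mean m n, 1). *)
Definition gaussian_law N (mean : 'I_M -> 'I_N -> R) :
    probability (observation N) R :=
  tuple_law (fun n => tuple_law (fun m => normal_prob (mean m n) 1)).

Definition law_H0 N : probability (observation N) R :=
  gaussian_law (fun _ _ => 0).

Definition law_H1 P pi beta N (A : set (observation N.+1)) : \bar R :=
  (\sum_(s : {ffun 'I_N.+1 -> 'I_M})
     (path_prob P pi s)%:E *
     gaussian_law (fun m n => if m == s n then beta else 0%R) A)%E.

(* A detector is given by the set [D] of observations on which it decides H1,
   so its false alarm probability is [law_H0 D]. *)
Definition miss_prob P pi beta N (D : set (observation N.+1)) : \bar R :=
  law_H1 P pi beta (~` D).

Definition optimal_detector P pi beta eps N (D : set (observation N.+1)) : Prop :=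
  [/\ measurable D, (law_H0 N.+1 D <= eps%:E)%E &
    forall D' : set (observation N.+1),
      measurable D' -> (law_H0 N.+1 D' <= eps%:E)%E ->
      (miss_prob P pi beta D <= miss_prob P pi beta D')%E].

(* [delta N] is the detector for data of length [N.+1]. *)
Definition error_exponent P pi beta
    (delta : forall N, set (observation N.+1)) eta : Prop :=
  (fun N => - (ln (fine (miss_prob P pi beta (delta N))) / N.+1%:R)) @ \oo
    --> eta.

End Detection.

(* Main.v *)
(* Write [Lam t = ln (lambda_max (tilted P t))].  The Perron vectors give a tangent
   inequality for [Lam] (Jensen for the logarithm along the stationary Markov chain
   attached to [tilted P t]), and the left Perron vector of sum 1 is continuous in [t]
   because it solves an invertible linear system; hence [Lam] is convex and
   differentiable, with [Lam 1 = 0] and [Lam' 1 = - H].  Since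
   [beta_t ^+ 2 / 2 = - (Lam t / t)'], the function [chi] is
   [beta ^+ 2 / 2 - min_t (Lam t / t + t * beta ^+ 2 / 2)].

   For the exponent it suffices to bound, for each [t] in (0, 1], the miss probability
   of one detector of level [eps].  If [L = \sum_s P(s) L_s] is the likelihood ratio,
   then [L <= Z `^ t^-1] with [Z = \sum_s (P(s) L_s) `^ t], and the detector [tau < Z]
   with [tau = E_0 Z / eps] misses with probability at most [tau `^ t^-1].  Finally
   [E_0 Z] is a Gaussian factor times [\sum_s P(s) `^ t], which grows as
   [lambda_max (tilted P t) ^+ N]. *)
Require Import Defs.
From HB Require Import structures.
From mathcomp Require Import all_boot all_order all_algebra.
From mathcomp Require Import complex ring lra.
From mathcomp Require Import all_classical all_reals all_analysis measurable_realfun.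

Set Implicit Arguments.
Unset Strict Implicit.
Unset Printing Implicit Defensive.

Import Order.TTheory GRing.Theory Num.Theory.
Import numFieldNormedType.Exports.

Local Open Scope classical_set_scope.
Local Open Scope ring_scope.

(** * Perron-Frobenius theory of irreducible matrices *)

Lemma cvg_sumr {K : numFieldType} {T I : Type} (F : set_system T) {FF : Filter F}
    (s : seq I) (f : I -> T -> K) (a : I -> K) :
  (forall i, f i x @[x --> F] --> a i) ->
  \sum_(i <- s) f i x @[x --> F] --> \sum_(i <- s) a i.
Proof.
move=> fa; elim: s => [|i s IH].
  by under eq_fun do rewrite big_nil; rewrite big_nil; exact: cvg_cst.
by under eq_fun do rewrite big_cons; rewrite big_cons; exact: cvgD.
Qed.

Lemma cvg_bigmaxr {K : realType} {T I : Type} (F : set_system T) {FF : Filter F}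
    (s : seq I) (x0 : K) (f : I -> T -> K) (a : I -> K) :
  (forall i, f i x @[x --> F] --> a i) ->
  \big[Order.max/x0]_(i <- s) f i x @[x --> F] --> \big[Order.max/x0]_(i <- s) a i.
Proof.
move=> fa; elim: s => [|i s IH].
  by under eq_fun do rewrite big_nil; rewrite big_nil; exact: cvg_cst.
under eq_fun do rewrite big_cons maxr_absE; rewrite big_cons maxr_absE.
apply: cvgM; last exact: cvg_cst.
by apply: cvgD; [exact: cvgD|apply: cvg_norm; exact: cvgB].
Qed.

Lemma sumr_ord_gt0 {R : realType} {M : nat} (f : 'I_M -> R) :
  (0 < M)%N -> (forall i, 0 < f i) -> 0 < \sum_i f i.
Proof.
move=> M0 f0; rewrite (bigD1 (Ordinal M0))//= ltr_pwDl//.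
by apply: sumr_ge0 => i _; exact: ltW.
Qed.

Section IrreducibleMatrices.
Context {R : realType} {M : nat}.
Implicit Types (A B : 'M[R]_M) (x y : 'rV[R]_M).

Definition nonneg_mx m n (A : 'M[R]_(m, n)) : Prop := forall i j, 0 <= A i j.

Lemma nonneg_mulmx m n p (A : 'M[R]_(m, n)) (B : 'M[R]_(n, p)) :
  nonneg_mx A -> nonneg_mx B -> nonneg_mx (A *m B).
Proof.
by move=> A0 B0 i j; rewrite mxE; apply: sumr_ge0 => k _; apply: mulr_ge0.
Qed.

Lemma nonneg_expmx A k : nonneg_mx A -> nonneg_mx (A ^+ k).
Proof.
move=> A0; elim: k => [|k IH]; last by rewrite exprS; apply: nonneg_mulmx.
by move=> i j; rewrite expr0 mxE; case: (i == j).
Qed.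

Lemma mulmx_expmx_eigen A x (r : R) k : x *m A = r *: x -> x *m A ^+ k = r ^+ k *: x.
Proof.
move=> xA; elim: k => [|k IH]; first by rewrite !expr0 mulmx1 scale1r.
by rewrite exprSr mulmxA IH -scalemxAl xA scalerA -exprSr.
Qed.

Lemma irreducible_trmx A : irreducible_chain A -> irreducible_chain A^T.
Proof.
move=> irrA i j; have [k Ak] := irrA j i; exists k.
suff -> : A^T ^+ k = (A ^+ k)^T by rewrite mxE.
by elim: k {Ak} => [|k IH]; rewrite ?expr0 ?trmx1// exprSr exprS IH trmx_mul.
Qed.

(** A nonzero entry [x 0 j] feeds entry [i] through some power of [A], and the eigenvector equation
    turns this into [0 < r ^+ k * x 0 i]. *)
Lemma irreducible_eigen_gt0 A x (r : R) :
  nonneg_mx A -> irreducible_chain A -> nonneg_mx x -> x != 0 ->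
  x *m A = r *: x -> forall i, 0 < x 0 i.
Proof.
move=> A0 irrA x0 xn0 xA i.
have /rV0Pn [j xj] := xn0.
have [k Ak] := irrA j i.
have : 0 < (x *m A ^+ k) 0 i.
  rewrite mxE (bigD1 j)//= ltr_pwDl//.
    by rewrite mulr_gt0// lt0r xj x0.
  by apply: sumr_ge0 => l _; apply: mulr_ge0 => //; exact: nonneg_expmx.
rewrite (mulmx_expmx_eigen _ xA) mxE => /lt0r_neq0.
by rewrite mulf_eq0 negb_or => /andP[_ xi]; rewrite lt0r xi x0.
Qed.

(** Every pair [(i, j)] contributes its own power of [A], so the sum is positive at each entry; as a
    sum of powers it commutes with [A]. *)
Lemma irreducible_sum_expmx A : nonneg_mx A -> irreducible_chain A ->
  exists C : 'M[R]_M, (forall i j, 0 < C i j) /\ C *m A = A *m C.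
Proof.
move=> A0 irrA.
have [k Ak] : {k : 'I_M -> 'I_M -> nat & forall i j, 0 < (A ^+ k i j) i j}.
  exists (fun i j => sval (cid (irrA i j))) => i j; by case: cid.
exists (\sum_i \sum_j A ^+ k i j); split=> [i j|].
  rewrite summxE (bigD1 i)//= ltr_pwDl//.
    rewrite summxE (bigD1 j)//= ltr_pwDl//.
    by apply: sumr_ge0 => l _; exact: nonneg_expmx.
  apply: sumr_ge0 => l _; rewrite summxE.
  by apply: sumr_ge0 => l' _; exact: nonneg_expmx.
rewrite mulmx_suml mulmx_sumr; apply: eq_bigr => i _.
rewrite mulmx_suml mulmx_sumr; apply: eq_bigr => j _.
by rewrite [LHS](esym (exprSr A _)) [RHS](esym (exprS A _)).
Qed.

(* The vector is [x C], where [C] is a positive matrix commuting with [A] and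
   [x] minimizes over the simplex the largest ratio [(x C A)_i / (x C)_i]: if
   some ratio were smaller than the minimum [r], then passing from [x] to [x C]
   would make them all smaller. *)
Lemma irreducible_eigen_ex A : (0 < M)%N -> nonneg_mx A -> irreducible_chain A ->
  exists (x : 'rV[R]_M) (r : R), [/\ forall i, 0 < x 0 i, 0 <= r & x *m A = r *: x].
Proof.
move=> M0 A0 irrA; have [C [C0 CA]] := irreducible_sum_expmx A0 irrA.
pose K := [set x : 'rV[R]_M | nonneg_mx x /\ \sum_i x 0 i = 1].
have KC x : nonneg_mx x -> x != 0 -> forall i, 0 < (x *m C) 0 i.
  move=> x0 /rV0Pn [j xj] i; rewrite mxE (bigD1 j)//= ltr_pwDl//.
    by rewrite mulr_gt0// lt0r xj x0.
  by apply: sumr_ge0 => l _; apply: mulr_ge0 => //; exact: ltW.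
have Kn0 x : K x -> x != 0.
  move=> [_ /eqP]; apply: contraTneq => ->.
  by under eq_bigr do rewrite mxE; rewrite big1// eq_sym oner_eq0.
have cM (B : 'M[R]_M) i : continuous (fun x : 'rV[R]_M => (x *m B) 0 i).
  under [X in continuous X]eq_fun do rewrite mxE.
  move=> x; apply: (@cvg_sumr _ _ _ (nbhs x)) => j; apply: cvgM; last exact: cvg_cst.
  exact: coord_continuous.
have cK : compact K.
  apply: (@subclosed_compact _ _ [set v : 'rV[R]_M | forall i, `[0, 1]%classic (v 0 i)]).
  - have -> : K = (\bigcap_(i in [set: 'I_M]) [set x : 'rV[R]_M | 0 <= x 0 i]) `&`
        [set x : 'rV[R]_M | \sum_i x 0 i = 1].
      apply/seteqP; split=> x /= [x0 x1]; split=> //.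
      + by move=> i _; apply: x0.
      + by move=> i j; rewrite (ord1 i); exact: (x0 j).
    apply: closedI.
      apply: closed_bigI => i _.
      apply: (@preimage_closed _ _ (fun x : 'rV[R]_M => x 0 i) [set r | 0 <= r]).
        by move=> x _; exact: coord_continuous.
      exact: closed_ge.
    apply: (@preimage_closed _ _ (fun x : 'rV[R]_M => \sum_i x 0 i) [set r | r = 1]).
      by move=> x _; apply: (@cvg_sumr _ _ _ (nbhs x)) => i; exact: coord_continuous.
    exact: closed_eq.
  - apply: (@rV_compact R M (fun=> `[0, 1]%classic)) => i; exact: segment_compact.
  - move=> x [x0 x1] i /=; rewrite in_itv/= x0/= -x1 (bigD1 i)//= lerDl.
    by apply: sumr_ge0.
(* Ratios are taken at [x *m C], which is positive on all of [K], boundary included, so no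
   denominator vanishes. *)
pose f x := \big[Order.max/0]_i ((x *m (C *m A)) 0 i / (x *m C) 0 i).
have cf : {within K, continuous f}.
  apply: continuous_in_subspaceT => x; rewrite inE => Kx.
  apply: (@cvg_bigmaxr _ _ _ (nbhs x)) => i.
  apply: (@cvgM _ _ (nbhs x)); first exact: (cM _ i x).
  apply: (@cvgV _ _ (nbhs x)); last exact: (cM _ i x).
  by rewrite lt0r_neq0//; apply: KC; [case: Kx|exact: Kn0].
have [z Kz minz] : exists2 c, c \in K & forall t, t \in K -> f c <= f t.
  apply: compact_EVT_min => //.
  exists (\row_i ((i == Ordinal M0)%:R)); split.
    by move=> i j; rewrite mxE ler0n.
  rewrite (bigD1 (Ordinal M0))//= mxE eqxx big1 ?addr0// => i /negbTE.
  by rewrite mxE => ->.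
move: Kz; rewrite inE => Kz; have [z0 z1] := Kz.
pose y := z *m C; pose r := f z.
have y0 : forall i, 0 < y 0 i by apply: KC => //; exact: Kn0.
have nny : nonneg_mx y by move=> i j; rewrite (ord1 i) ltW.
have r0 : 0 <= r by rewrite /r /f; apply: bigmax_ge_id.
have yA i : (y *m A) 0 i <= r * y 0 i.
  rewrite -ler_pdivrMr// -mulmxA.
  exact: (le_bigmax 0 (fun i => (z *m (C *m A)) 0 i / (z *m C) 0 i)).
exists y, r; split=> //.
apply/eqP; apply: contraT => yAr.
pose w := r *: y - y *m A.
have w0 : nonneg_mx w.
  by move=> i j; rewrite (ord1 i) mxE [X in X + _]mxE [X in _ + X]mxE subr_ge0; exact: yA.
have wn0 : w != 0 by rewrite subr_eq0 eq_sym.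
(* The maximum in [f] has default value 0, so the strict inequality [f u < r] requires [0 < r]. *)
have rgt0 : 0 < r.
  rewrite lt0r r0 andbT; apply: contraNneq wn0 => req.
  rewrite /w req scale0r sub0r oppr_eq0; apply/eqP/rowP => i; rewrite [RHS]mxE.
  apply/eqP; rewrite eq_le nonneg_mulmx// andbT.
  by have := yA i; rewrite req mul0r.
have wC := KC _ w0 wn0.
have S0 := sumr_ord_gt0 M0 y0.
pose u := (\sum_i y 0 i)^-1 *: y.
have Ku : K u.
  split; first by move=> i j; rewrite mxE mulr_ge0// invr_ge0 ltW.
  under eq_bigr do rewrite mxE.
  by rewrite -mulr_sumr mulVf// lt0r_neq0.
have := minz u; rewrite inE => /(_ Ku); rewrite leNgt => /negP[].
apply: bigmax_lt => // i _.
have yn0 : y != 0.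
  by apply/negP => /eqP y00; have := y0 (Ordinal M0); rewrite y00 mxE ltxx.
have yC := KC _ nny yn0 i.
have uE B : (u *m B) 0 i = (\sum_i y 0 i)^-1 * (y *m B) 0 i.
  by rewrite /u -scalemxAl mxE.
rewrite CA !uE mulmxA -mulf_div divff ?mul1r; last first.
  by rewrite invr_neq0// lt0r_neq0.
rewrite ltr_pdivrMr// -subr_gt0.
by have := wC i; rewrite /w mulmxBl -scalemxAl mxE [X in X + _]mxE [X in _ + X]mxE.
Qed.

(** The right vector is a left vector of [A^T]. Evaluating [x *m A *m y^T] in two ways identifies
    the eigenvalues, since two positive vectors have a nonzero pairing. *)
Lemma irreducible_perron_ex A : (0 < M)%N -> nonneg_mx A -> irreducible_chain A ->
  exists (x : 'rV[R]_M) (y : 'cV[R]_M) (r : R),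
    [/\ forall i, 0 < x 0 i, forall i, 0 < y i 0, x *m A = r *: x & A *m y = r *: y].
Proof.
move=> M0 A0 irrA.
have [x [r [x0 _ xA]]] := irreducible_eigen_ex M0 A0 irrA.
have [y [q [y0 _ yA]]] : exists (y : 'rV[R]_M) (q : R),
    [/\ forall i, 0 < y 0 i, 0 <= q & y *m A^T = q *: y].
  apply: irreducible_eigen_ex => //; last exact: irreducible_trmx.
  by move=> i j; rewrite mxE.
have Ay : A *m y^T = q *: y^T by rewrite -[LHS]trmxK trmx_mul trmxK yA linearZ.
exists x, y^T, r; split=> // [i|]; first by rewrite mxE.
rewrite Ay; congr (_ *: _).
have xy0 : (x *m y^T) 0 0 != 0.
  rewrite lt0r_neq0// mxE; apply: sumr_ord_gt0 => // i.
  by rewrite mxE mulr_gt0.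
apply: (mulIf xy0); transitivity ((x *m A *m y^T) 0 0).
  by rewrite -mulmxA Ay -scalemxAr [RHS]mxE.
by rewrite xA -scalemxAl [LHS]mxE.
Qed.

(** If [v] is an eigenvector for a complex eigenvalue [z], the triangle inequality gives
    [|z| |v| <= |v| A] entrywise; pairing with the positive right vector [y] yields [|z| <= r]. *)
Lemma lambda_maxE A x (y : 'cV[R]_M) (r : R) : (0 < M)%N -> nonneg_mx A ->
  (forall i, 0 < x 0 i) -> (forall i, 0 < y i 0) ->
  x *m A = r *: x -> A *m y = r *: y -> lambda_max A = r.
Proof.
move=> M0 A0 x0 y0 xA Ay.
have sub (z : R[i]) : eigenvalue (map_mx (real_complex R) A) z ->
    `|z| <= real_complex R r.
  move=> /eigenvalueP[v vA /rV0Pn[j0 vj0]].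
  have S0 : 0 < \sum_j `|v 0 j| * (y j 0)%:C%C.
    rewrite (bigD1 j0)//= ltr_pwDl// ?mulr_gt0 ?normr_gt0 ?ltcR//.
    by apply: sumr_ge0 => i _; rewrite mulr_ge0// lecR ltW.
  rewrite -(ler_pM2r S0).
  apply: (@le_trans _ _ (\sum_j \sum_i `|v 0 i| * (A i j)%:C%C * (y j 0)%:C%C)).
    rewrite mulr_sumr; apply: ler_sum => j _.
    rewrite mulrA -mulr_suml; apply: ler_wpM2r; first by rewrite lecR ltW.
    have -> : `|z| * `|v 0 j| = `|\sum_i v 0 i * (A i j)%:C%C|.
      rewrite -normrM; have /rowP/(_ j) := vA.
      by rewrite !mxE => <-; under eq_bigr do rewrite mxE.
    apply: (le_trans (ler_norm_sum _ _ _)); apply: ler_sum => i _.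
    by rewrite normrM [X in _ * X]ger0_norm // lecR.
  rewrite exchange_big mulr_sumr /=; apply: ler_sum => i _.
  under eq_bigr do rewrite -mulrA; rewrite -mulr_sumr mulrCA.
  apply: ler_wpM2l => //.
  have /matrixP/(_ i 0) := Ay; rewrite !mxE => Ayi.
  under eq_bigr do rewrite -rmorphM; rewrite -rmorph_sum /= Ayi.
  by rewrite -rmorphM lecR.
have eig q (v : 'rV[R]_M) : v *m A = q *: v -> v != 0 -> `|q| <= r.
  move=> vA v0; have := sub (real_complex R q).
  rewrite normc_def /= expr0n addr0 sqrtr_sqr lecR; apply.
  apply/eigenvalueP; exists (map_mx (real_complex R) v).
    by rewrite -map_mxM vA map_mxZ.
  by rewrite map_mx_eq0.
have xn0 : x != 0 by apply/rV0Pn; exists (Ordinal M0); rewrite lt0r_neq0.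
have r0 : 0 <= r by apply: le_trans (eig _ _ xA xn0).
apply: xget_unique => /= [|q [/eigenvalueP[v vA v0] qmax]].
  by split=> //; apply/eigenvalueP; exists x.
apply/eqP; rewrite eq_le (le_trans (ler_norm q))/= ?(eig _ _ vA)//.
have := qmax (real_complex R r).
rewrite normc_def /= expr0n addr0 sqrtr_sqr lecR => rq.
apply: le_trans (ler_norm r) (rq _).
apply/eigenvalueP; exists (map_mx (real_complex R) x).
  by rewrite -map_mxM xA map_mxZ.
by rewrite map_mx_eq0.
Qed.

(** Subtract from [v] the largest multiple of [x] that leaves a nonnegative remainder. The remainder
    vanishes at [k], while a nonzero nonnegative eigenvector would be positive everywhere. *)
Lemma irreducible_eigen_simple A x v (r : R) : (0 < M)%N ->
  nonneg_mx A -> irreducible_chain A -> (forall i, 0 < x 0 i) ->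
  x *m A = r *: x -> v *m A = r *: v -> exists c, v = c *: x.
Proof.
move=> M0 A0 irrA x0 xA vA.
have [k _ kmin] := arg_minP (fun i => v 0 i / x 0 i) (erefl (xpredT (Ordinal M0))).
exists (v 0 k / x 0 k); apply/eqP; rewrite -subr_eq0; apply: contraT => wn0.
have := @irreducible_eigen_gt0 A _ r A0 irrA _ wn0.
have w0 : nonneg_mx (v - (v 0 k / x 0 k) *: x).
  by move=> i j; rewrite (ord1 i) !mxE subr_ge0 -ler_pdivlMr// kmin.
have wA : (v - (v 0 k / x 0 k) *: x) *m A = r *: (v - (v 0 k / x 0 k) *: x).
  by rewrite mulmxBl -scalemxAl xA vA scalerBr !scalerA mulrC.
move=> /(_ w0 wA k); rewrite !mxE divfK ?subrr ?ltxx//.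
by rewrite lt0r_neq0.
Qed.

(* [r I - A] is singular, but adding the all-ones matrix makes it invertible;
   a left eigenvector of sum 1 is then the solution of a linear system. *)
Lemma irreducible_bordered_unitmx A x (y : 'cV[R]_M) (r : R) : (0 < M)%N ->
  nonneg_mx A -> irreducible_chain A ->
  (forall i, 0 < x 0 i) -> (forall i, 0 < y i 0) ->
  x *m A = r *: x -> A *m y = r *: y ->
  (r%:M - A + const_mx 1 : 'M[R]_M) \in unitmx.
Proof.
move=> M0 A0 irrA x0 y0 xA Ay; rewrite -row_free_unit; apply: inj_row_free => v vB.
have vJ i : (v *m (const_mx 1 : 'M[R]_M)) 0 i = \sum_j v 0 j.
  by rewrite mxE; apply: eq_bigr => j _; rewrite mxE mulr1.
(* Pairing with [y] kills [r%:M - A] and leaves the product of the two sums. *)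
have v0 : \sum_j v 0 j = 0.
  suff /eqP : (\sum_j v 0 j) * (\sum_j y j 0) = 0.
    by rewrite mulf_eq0 (gt_eqF (sumr_ord_gt0 M0 y0)) orbF => /eqP.
  transitivity ((v *m (const_mx 1 : 'M[R]_M) *m y) 0 0).
    by rewrite mxE mulr_sumr; apply: eq_bigr => i _; rewrite vJ.
  have := congr1 (mulmx^~ y) vB => /=.
  rewrite mul0mx mulmxDr mulmxDl -[v *m (r%:M - A) *m y]mulmxA.
  by rewrite mulmxBl mul_scalar_mx Ay subrr mulmx0 add0r => ->; rewrite mxE.
have vA : v *m A = r *: v.
  have vJ0 : v *m (const_mx 1 : 'M[R]_M) = 0.
    by apply/rowP => i; rewrite vJ v0 mxE.
  move/eqP: vB; rewrite mulmxDr vJ0 addr0 mulmxBr mul_mx_scalar subr_eq0.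
  by move/eqP => ->.
have [c vE] := irreducible_eigen_simple M0 A0 irrA x0 xA vA.
rewrite vE; suff -> : c = 0 by rewrite scale0r.
suff /eqP : c * (\sum_j x 0 j) = 0.
  by rewrite mulf_eq0 (gt_eqF (sumr_ord_gt0 M0 x0)) orbF => /eqP.
by rewrite -[RHS]v0 mulr_sumr; apply: eq_bigr => i _; rewrite vE mxE.
Qed.

End IrreducibleMatrices.

(** * The Perron root of the tilted matrices *)

Lemma cvg_dist_squeeze {R : realType} {T : Type} (F : set_system T) {FF : Filter F}
    (f g : T -> R) (l : R) :
  (forall x, `|f x - l| <= g x) -> g x @[x --> F] --> 0 -> f x @[x --> F] --> l.
Proof.
move=> fg g0; apply: (@squeeze_cvgr _ _ _ _ (fun x => l - g x) (fun x => l + g x)).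
- by apply: nearW => x; rewrite -ler_distl.
- by rewrite -[X in _ --> X]subr0; apply: cvgB => //; exact: cvg_cst.
- by rewrite -[X in _ --> X]addr0; apply: cvgD => //; exact: cvg_cst.
Qed.

Lemma cvg_shift_scale {R : realType} (s : R) : h *: 1 + s @[h --> (0 : R)^'] --> s.
Proof.
rewrite -[X in _ --> X](add0r s); apply: cvgD; last exact: cvg_cst.
rewrite -[X in _ --> X](mul0r 1); apply: cvgM; last exact: cvg_cst.
exact: nbhs_dnbhs.
Qed.

Section TiltedMatrices.
Context {R : realType} {M : nat}.
Variable P : 'M[R]_M.
Hypotheses (hP : stochastic P) (irrP : irreducible_chain P) (M0 : (0 < M)%N).
Implicit Types (s t : R) (a : 'rV[R]_M) (b : 'cV[R]_M).

Let P0 : nonneg_mx P. Proof. by case: hP. Qed.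

Lemma tilted_gt0 t i j : 0 < P i j -> 0 < tilted P t i j.
Proof. by move=> Pij; rewrite mxE gt_eqF// powR_gt0. Qed.

Lemma ln_tilted t i j : 0 < P i j -> ln (tilted P t i j) = t * log_mx P i j.
Proof. by move=> Pij; rewrite !mxE gt_eqF// ln_powR. Qed.

Lemma nonneg_tilted t : nonneg_mx (tilted P t).
Proof. by move=> i j; rewrite mxE; case: eqP => // _; exact: powR_ge0. Qed.

Lemma tilted1 : tilted P 1 = P.
Proof. by apply/matrixP => i j; rewrite mxE; case: eqP => // _; rewrite powRr1. Qed.

(** Tilting keeps positive entries positive, so the same power [k] works. *)
Lemma irreducible_tilted t : irreducible_chain (tilted P t).
Proof.
move=> i j; have [k Pk] := irrP i j; exists k.
elim: k j Pk => [|k IH] j; first by rewrite !expr0.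
rewrite exprSr mxE => S0.
have [l] : exists l, 0 < (P ^+ k) i l * P l j.
  apply: contrapT => /forallNP Sle; move: S0; rewrite ltNge => /negP; apply.
  by apply: sumr_le0 => l _; rewrite leNgt; apply/negP/Sle.
have Pk0 := nonneg_expmx k P0 i l.
rewrite lt0r mulf_eq0 negb_or => /andP[/andP[kn0 ln0] _].
rewrite exprSr mxE (bigD1 l)//= ltr_pwDl//.
  by rewrite mulr_gt0 ?IH ?tilted_gt0// lt0r ?kn0 ?ln0 ?P0.
apply: sumr_ge0 => m _; apply: mulr_ge0; last exact: nonneg_tilted.
exact: (nonneg_expmx k (@nonneg_tilted t) i m).
Qed.

(** The left vector is normalized because its continuity in [t] is used; the right vector stays at a
    fixed parameter in the difference quotient of [lam], so its scale is left free. *)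
Definition perron_data t (ab : 'rV[R]_M * 'cV[R]_M) : Prop :=
  [/\ (forall i, 0 < ab.1 0 i) /\ (forall i, 0 < ab.2 i 0),
      \sum_i ab.1 0 i = 1,
      ab.1 *m tilted P t = lambda_max (tilted P t) *: ab.1 &
      tilted P t *m ab.2 = lambda_max (tilted P t) *: ab.2].

Lemma perron_data_ex t : exists ab, perron_data t ab.
Proof.
have [a [b [r [a0 b0 aA Ab]]]] :=
  irreducible_perron_ex M0 (@nonneg_tilted t) (@irreducible_tilted t).
have rE := lambda_maxE M0 (@nonneg_tilted t) a0 b0 aA Ab.
have S0 := sumr_ord_gt0 M0 a0.
exists ((\sum_i a 0 i)^-1 *: a, b); split=> //=; rewrite ?rE//.
- by split=> // i; rewrite mxE mulr_gt0// invr_gt0.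
- by under eq_bigr do rewrite mxE; rewrite -mulr_sumr mulVf// gt_eqF.
- by rewrite -scalemxAl aA !scalerA mulrC.
Qed.

Definition perron_vectors t := sval (cid (perron_data_ex t)).
Definition left_vec t : 'rV[R]_M := (perron_vectors t).1.
Definition right_vec t : 'cV[R]_M := (perron_vectors t).2.
Definition lam t : R := lambda_max (tilted P t).

Lemma left_vec_gt0 t i : 0 < left_vec t 0 i.
Proof. by rewrite /left_vec /perron_vectors; case: cid => ab [[]]. Qed.

Lemma right_vec_gt0 t i : 0 < right_vec t i 0.
Proof. by rewrite /right_vec /perron_vectors; case: cid => ab [[]]. Qed.

Lemma sum_left_vec t : \sum_i left_vec t 0 i = 1.
Proof. by rewrite /left_vec /perron_vectors; case: cid => ab [[]]. Qed.

Lemma left_vecE t : left_vec t *m tilted P t = lam t *: left_vec t.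
Proof. by rewrite /left_vec /perron_vectors; case: cid => ab [[]]. Qed.

Lemma right_vecE t : tilted P t *m right_vec t = lam t *: right_vec t.
Proof. by rewrite /right_vec /perron_vectors; case: cid => ab [[]]. Qed.

Lemma lam_gt0 t : 0 < lam t.
Proof.
have i := Ordinal M0.
have [j Pij] : exists j, 0 < P i j.
  apply: contrapT => /forallNP Ple; have := hP.2 i; apply/eqP.
  rewrite lt_eqF// (@le_lt_trans _ _ 0)//; apply: sumr_le0 => j _.
  by rewrite leNgt; apply/negP.
have := congr1 (fun x : 'cV_M => x i 0) (right_vecE t); rewrite !mxE => lamE.
rewrite -(pmulr_lgt0 _ (right_vec_gt0 t i)) -lamE (bigD1 j)//= ltr_pwDl//.
  by rewrite mulr_gt0 ?right_vec_gt0// tilted_gt0.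
by apply: sumr_ge0 => k _; rewrite mulr_ge0 ?nonneg_tilted// ltW// right_vec_gt0.
Qed.

(** The numerator in the formula for [rho], with [a] already a row. *)
Definition tilt_num t a b : R := (a *m map2_mx *%R (log_mx P) (tilted P t) *m b) 0 0.

Lemma bilinear_entry n (A : 'M[R]_M) a (B : 'M[R]_(M, n)) k :
  (a *m A *m B) 0 k = \sum_i \sum_j a 0 i * A i j * B j k.
Proof.
rewrite mxE exchange_big /=; apply: eq_bigr => j _.
by rewrite mxE mulr_suml.
Qed.

(* Sum [ln z <= z - 1] with weights [a i * A_s i j * b_s j], where [z] is the
   ratio of the transition probabilities [A i j * b j / (lam * b i)] at [t] and
   [s]; the terms in [b] cancel because these weights have equal marginals. *)
Lemma log_lambda_tangent s t a b :
  (forall i, 0 < a 0 i) -> (forall i, 0 < b i 0) ->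
  a *m tilted P s = lam s *: a -> tilted P s *m b = lam s *: b ->
  (t - s) * tilt_num s a b <=
  (log_lambda P t - log_lambda P s) * (a *m tilted P s *m b) 0 0.
Proof.
move=> a0 b0 aA Ab.
pose c := right_vec t; have c0 := right_vec_gt0 t.
pose w i j := a 0 i * tilted P s i j * b j 0.
have rowsum i : \sum_j tilted P s i j * b j 0 = lam s * b i 0.
  by have := congr1 (fun x : 'cV_M => x i 0) Ab; rewrite !mxE.
have colsum j : \sum_i a 0 i * tilted P s i j = lam s * a 0 j.
  by have := congr1 (fun x : 'rV_M => x 0 j) aA; rewrite !mxE.
have rowsumt i : \sum_j tilted P t i j * c j 0 = lam t * c i 0.
  by have := congr1 (fun x : 'cV_M => x i 0) (right_vecE t); rewrite !mxE.
pose f i := ln (c i 0 / b i 0).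
have wf : \sum_i \sum_j w i j * f j = \sum_i \sum_j w i j * f i.
  rewrite exchange_big /=.
  transitivity (\sum_i lam s * a 0 i * b i 0 * f i).
    by apply: eq_bigr => j _; rewrite -mulr_suml -mulr_suml colsum.
  apply: eq_bigr => i _; rewrite -mulr_suml; congr (_ * _).
  under eq_bigr do rewrite /w -mulrA; rewrite -mulr_sumr rowsum.
  by rewrite mulrCA mulrA.
have ratio_eq (l1 l2 ci cj bi bj As At ai : R) :
    l2 != 0 -> ci != 0 -> bj != 0 -> As != 0 ->
    ai * (l1 * bi / (l2 * ci)) * (At * cj) - ai * As * bj =
    ai * As * bj * (At * cj * (l1 * bi) / (As * bj * (l2 * ci)) - 1).
  by move=> l20 ci0 bj0 As0; field; rewrite l20 ci0 bj0 As0.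
have log_ratio_eq (L x1 x2 y1 y2 y3 y4 : R) :
    (t - s) * L + (y1 - y2) - (y3 - y4) + (x1 - x2) =
    t * L + y1 + (x1 + y4) - (s * L + y2 + (x2 + y3)) by ring.
have weight_eq (v d L f1 f2 x : R) :
    v * (d * L + f1 - f2 + x) = d * (v * L) + (v * f1 - v * f2) + x * v by ring.
have key i j : w i j * ((t - s) * log_mx P i j + f j - f i + (log_lambda P s - log_lambda P t))
    <= a 0 i * (lam s * b i 0 / (lam t * c i 0)) * (tilted P t i j * c j 0) - w i j.
  have [Pij|Pij] := eqVneq (P i j) 0.
    by rewrite /w !mxE Pij eqxx !(mulr0, mul0r) subr0.
  have {}Pij : 0 < P i j by rewrite lt0r Pij P0.
  have Asij := tilted_gt0 s Pij; have Atij := tilted_gt0 t Pij.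
  pose z := (tilted P t i j * c j 0 * (lam s * b i 0)) / (tilted P s i j * b j 0 * (lam t * c i 0)).
  have z0 : 0 < z by rewrite divr_gt0 ?mulr_gt0 ?lam_gt0.
  have -> : (t - s) * log_mx P i j + f j - f i + (log_lambda P s - log_lambda P t) = ln z.
    rewrite /f /z !ln_div ?posrE ?mulr_gt0 ?lam_gt0//.
    rewrite !lnM ?posrE ?mulr_gt0 ?lam_gt0//.
    rewrite (ln_tilted s Pij) (ln_tilted t Pij).
    rewrite -[log_lambda P s]/(ln (lam s)) -[log_lambda P t]/(ln (lam t)).
    exact: log_ratio_eq.
  have -> : a 0 i * (lam s * b i 0 / (lam t * c i 0)) * (tilted P t i j * c j 0) - w i j = w i j * (z - 1).
    by apply: ratio_eq; rewrite gt_eqF ?lam_gt0.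
  rewrite ler_wpM2l ?mulr_ge0 ?(ltW (a0 i)) ?(ltW (b0 j)) ?(ltW Asij)//.
  have := @le_ln1Dx R (z - 1); rewrite [1 + _]addrC subrK; apply.
  by rewrite ltrBDr addNr.
have sumw : (a *m tilted P s *m b) 0 0 = \sum_i \sum_j w i j by rewrite bilinear_entry.
have sumwL : tilt_num s a b = \sum_i \sum_j w i j * log_mx P i j.
  rewrite /tilt_num bilinear_entry; apply: eq_bigr => i _; apply: eq_bigr => j _.
  by rewrite /w [in LHS]mxE -!mulrA; congr (_ * _); rewrite mulrC -mulrA.
rewrite -subr_ge0 sumw sumwL.
(* Summing over [j] with the eigenvector equation of [c] turns the first term into
   [lam s * a 0 i * b i 0], which is also the row sum of [w]. *)
have rhs0 : \sum_i \sum_j (a 0 i * (lam s * b i 0 / (lam t * c i 0)) * (tilted P t i j * c j 0)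
    - w i j) = 0.
  apply: big1 => i _; rewrite sumrB -mulr_sumr rowsumt.
  under eq_bigr do rewrite /w -mulrA; rewrite -mulr_sumr rowsum.
  by rewrite -[X in X - _]mulrA divfK ?subrr// gt_eqF// mulr_gt0// lam_gt0.
have := ler_sum (index_enum 'I_M) (P := xpredT) (fun i _ =>
  ler_sum (index_enum 'I_M) (P := xpredT) (fun j _ => key i j)).
rewrite rhs0 -subr_ge0 sub0r => /le_trans; apply.
rewrite -subr_ge0 le_eqVlt; apply/orP; left; rewrite eq_sym subr_eq0; apply/eqP.
have -> : \sum_i \sum_j w i j * ((t - s) * log_mx P i j + f j - f i +
    (log_lambda P s - log_lambda P t)) =
  (t - s) * (\sum_i \sum_j w i j * log_mx P i j) +
  (\sum_i \sum_j w i j * f j - \sum_i \sum_j w i j * f i) +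
  (log_lambda P s - log_lambda P t) * (\sum_i \sum_j w i j).
  rewrite !mulr_sumr -sumrB -!big_split /=; apply: eq_bigr => i _.
  rewrite !mulr_sumr -sumrB -!big_split /=; apply: eq_bigr => j _; 
  move: (w i j) (log_mx P i j) (f j) (f i) (log_lambda P s - log_lambda P t).
  by move=> *; ring.
rewrite wf; move: (\sum_i \sum_j w i j) (\sum_i \sum_j w i j * f i)
  (\sum_i \sum_j w i j * log_mx P i j) (log_lambda P s) (log_lambda P t) => *.
ring.
Qed.

(** Bounds the tangent slope uniformly in [s], which provides a Lipschitz constant for
    [log_lambda P]. *)
Lemma normr_tilt_num s a b : (forall i, 0 < a 0 i) -> (forall i, 0 < b i 0) ->
  `|tilt_num s a b| <= (\sum_i \sum_j `|log_mx P i j|) * (a *m tilted P s *m b) 0 0.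
Proof.
move=> a0 b0; rewrite /tilt_num !bilinear_entry.
pose K := \sum_i \sum_j `|log_mx P i j|; rewrite -/K.
have LK i j : `|log_mx P i j| <= K.
  rewrite /K (bigD1 i)//= (bigD1 j)//= -addrA lerDl addr_ge0 ?sumr_ge0// => k _.
  by rewrite sumr_ge0.
apply: le_trans (ler_norm_sum _ _ _) _; rewrite mulr_sumr; apply: ler_sum => i _.
apply: le_trans (ler_norm_sum _ _ _) _; rewrite mulr_sumr; apply: ler_sum => j _.
rewrite [X in `|_ * X * _|]mxE 3!normrM (ger0_norm (ltW (a0 i))) (ger0_norm (ltW (b0 j))).
rewrite (ger0_norm (nonneg_tilted s i j)) mulrCA -[leLHS]mulrA.
by rewrite ler_wpM2r// !mulr_ge0 ?nonneg_tilted// ltW.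
Qed.

Lemma log_lambda_lipschitz s t :
  `|log_lambda P t - log_lambda P s| <= (\sum_i \sum_j `|log_mx P i j|) * `|t - s|.
Proof.
pose K := \sum_i \sum_j `|log_mx P i j|; rewrite -/K.
(* The tangent inequality bounds increments from below; exchanging the two points gives the upper
   bound. *)
have half u v : - (K * `|v - u|) <= log_lambda P v - log_lambda P u.
  have := log_lambda_tangent v (left_vec_gt0 u) (right_vec_gt0 u) (left_vecE u) (right_vecE u).
  have := normr_tilt_num u (left_vec_gt0 u) (right_vec_gt0 u); rewrite -/K.
  have : 0 < (left_vec u *m tilted P u *m right_vec u) 0 0.
    rewrite left_vecE -scalemxAl mxE mulr_gt0 ?lam_gt0// mxE.
    by apply: sumr_ord_gt0 => // i; rewrite mulr_gt0 ?left_vec_gt0 ?right_vec_gt0.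
  move: (_ 0 0) (tilt_num _ _ _) (log_lambda P v - _) => D N L D0 NK NL.
  rewrite -(ler_pM2r D0); apply: le_trans NL; rewrite mulNr lerNl.
  apply: (le_trans (ler_norm _)); rewrite normrN normrM mulrAC.
  by rewrite mulrC ler_wpM2r.
by rewrite ler_norml half/= -[leLHS]opprB lerNl distrC half.
Qed.

Lemma continuous_lam s : lam t @[t --> s] --> lam s.
Proof.
have -> : lam = expR \o log_lambda P.
  by apply/funext => t /=; rewrite /log_lambda -/(lam t) lnK// posrE lam_gt0.
apply: continuous_comp; last exact: continuous_expR.
apply: cvg_dist_squeeze (log_lambda_lipschitz s) _.
rewrite -[X in _ --> X](mulr0 (\sum_i \sum_j `|log_mx P i j|)).
apply: cvgM; first exact: cvg_cst.
rewrite -[X in _ --> X](@normr0 _ R); apply: cvg_norm.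
by rewrite -[X in _ --> X](subrr s); apply: cvgB => //; exact: cvg_cst.
Qed.

Lemma is_derive_tilted s i j :
  is_derive s 1 (fun t => tilted P t i j) (log_mx P i j * tilted P s i j).
Proof.
have [Pij|Pij] := eqVneq (P i j) 0.
  rewrite [X in is_derive _ _ X _](_ : _ = cst 0); last first.
    by apply/funext => t; rewrite mxE Pij eqxx.
  by rewrite !mxE Pij eqxx mulr0; exact: is_derive_cst.
rewrite [X in is_derive _ _ X _](_ : _ = expR \o (fun t => t * ln (P i j))); last first.
  by apply/funext => t; rewrite mxE (negbTE Pij) /powR (negbTE Pij).
rewrite !mxE (negbTE Pij) /powR (negbTE Pij) mulrC.
apply: is_derive1_comp; last first.
  apply: is_derive_eq.
  rewrite scaler0 add0r /GRing.scale/= mulr1//.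
Qed.

Lemma continuous_tilted s i j : tilted P t i j @[t --> s] --> tilted P s i j.
Proof.
have /derivable1_diffP/differentiable_continuous := @ex_derive _ _ _ _ _ _ _ (is_derive_tilted s i j).
exact.
Qed.

(** With [B t] the bordered matrix, [left_vec t *m B t] is the all-ones row for every [t]. Hence
    [left_vec t - left_vec s] equals [left_vec t *m (B s - B t) *m invmx (B s)], where the entries
    of [left_vec t] are at most 1 and [B t] tends to [B s]. *)
Lemma continuous_left_vec s i : left_vec t 0 i @[t --> s] --> left_vec s 0 i.
Proof.
pose B t : 'M[R]_M := (lam t)%:M - tilted P t + const_mx 1.
have BU : B s \in unitmx.
  apply: (irreducible_bordered_unitmx M0 (@nonneg_tilted s) (@irreducible_tilted s)
    (left_vec_gt0 s) (right_vec_gt0 s) (left_vecE s) (right_vecE s)).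
have aB t : left_vec t *m B t = const_mx 1.
  rewrite mulmxDr mulmxBr mul_mx_scalar left_vecE subrr add0r.
  apply/rowP => j; rewrite !mxE -[RHS](sum_left_vec t).
  by apply: eq_bigr => k _; rewrite mxE mulr1.
have diffE t : left_vec t - left_vec s = left_vec t *m (B s - B t) *m invmx (B s).
  by rewrite mulmxBr aB -(aB s) -mulmxBl mulmxK.
have a1 t k : `|left_vec t 0 k| <= 1.
  rewrite ger0_norm ?(ltW (left_vec_gt0 t k))// -(sum_left_vec t) (bigD1 k)//= lerDl.
  by apply: sumr_ge0 => l _; rewrite ltW// left_vec_gt0.
have entryE (l l' : R) (A A' : 'M[R]_M) k j :
    (l%:M - A + const_mx 1 - (l'%:M - A' + const_mx 1)) k j =
    (l - l') * (k == j)%:R - (A k j - A' k j).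
  by rewrite !mxE; case: (k == j); rewrite ?mulr1n ?mulr0n; ring.
apply: (@cvg_dist_squeeze _ _ _ _ _
  (fun t => \sum_k \sum_j `|(B s - B t) k j| * `|invmx (B s) j i|)).
  move=> t.
  have -> : left_vec t 0 i - left_vec s 0 i = (left_vec t - left_vec s) 0 i by rewrite !mxE.
  rewrite diffE bilinear_entry.
  apply: le_trans (ler_norm_sum _ _ _) _; apply: ler_sum => k _.
  apply: le_trans (ler_norm_sum _ _ _) _; apply: ler_sum => j _.
  by rewrite -mulrA normrM -[leRHS]normrM ler_piMl.
rewrite [X in _ --> X](_ : _ = \sum_(k < M) \sum_(j < M) 0 * `|invmx (B s) j i|); last first.
  by rewrite big1// => k _; rewrite big1// => j _; rewrite mul0r.
apply: (@cvg_sumr _ _ _ (nbhs s)) => k; apply: (@cvg_sumr _ _ _ (nbhs s)) => j.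
apply: cvgM; last exact: cvg_cst.
rewrite -[X in _ --> X](@normr0 _ R); apply: cvg_norm.
have -> : (fun t => (B s - B t) k j) =
    (fun t => (lam s - lam t) * (k == j)%:R - (tilted P s k j - tilted P t k j)).
  by apply/funext => t; exact: entryE.
rewrite -[X in _ --> X]subr0; apply: cvgB.
  rewrite -[X in _ --> X](mul0r (k == j)%:R); apply: cvgM; last exact: cvg_cst.
  rewrite -[X in _ --> X](subrr (lam s)).
  by apply: cvgB; [exact: cvg_cst|exact: continuous_lam].
rewrite -[X in _ --> X](subrr (tilted P s k j)).
by apply: cvgB; [exact: cvg_cst|exact: continuous_tilted].
Qed.

(** Placing [tilted P t - tilted P s] between [left_vec t] and [right_vec s] gives exactly
    [lam t - lam s] times their pairing. The limit of the difference quotient then follows from the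
    continuity of the left vector and the derivatives of the entries. *)
Lemma is_derive_lam s :
  is_derive s 1 lam (tilt_num s (left_vec s) (right_vec s) / (left_vec s *m right_vec s) 0 0).
Proof.
have D0 t : (left_vec t *m right_vec s) 0 0 != 0.
  rewrite gt_eqF// mxE; apply: sumr_ord_gt0 => // i.
  by rewrite mulr_gt0 ?left_vec_gt0 ?right_vec_gt0.
have quotE h : h^-1 *: ((lam \o shift s) (h *: 1) - lam s) =
    (\sum_i \sum_j left_vec (h *: 1 + s) 0 i *
       (h^-1 *: (((fun t => tilted P t i j) \o shift s) (h *: 1) - tilted P s i j)) *
       right_vec s j 0) / (left_vec (h *: 1 + s) *m right_vec s) 0 0.
  rewrite /=; move: (h *: 1 + s) => t; apply: (mulIf (D0 t)); rewrite divfK//.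
  have -> : h^-1 *: (lam t - lam s) * (left_vec t *m right_vec s) 0 0 =
      h^-1 * (left_vec t *m (tilted P t - tilted P s) *m right_vec s) 0 0.
    rewrite mulmxBr mulmxBl left_vecE -[in RHS]mulmxA right_vecE.
    by rewrite -scalemxAl -scalemxAr -scalerBl [in RHS]mxE -mulrA.
  rewrite bilinear_entry mulr_sumr; apply: eq_bigr => i _.
  rewrite mulr_sumr; apply: eq_bigr => j _.
  by rewrite [X in _ * X * _]mxE [in X in _ * (_ + X)]mxE mulrA mulrCA.
suff dq : h^-1 *: ((lam \o shift s) (h *: 1) - lam s) @[h --> (0 : R)^'] -->
    tilt_num s (left_vec s) (right_vec s) / (left_vec s *m right_vec s) 0 0.
  by split; [apply/cvg_ex; eexists; exact: dq|exact/cvg_lim].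
rewrite (eq_cvg _ _ quotE).
have cvga i : left_vec (h *: 1 + s) 0 i @[h --> (0 : R)^'] --> left_vec s 0 i.
  have := @cvg_comp _ _ _ (fun h : R => h *: 1 + s) (fun t => left_vec t 0 i) _ _ _
    (@cvg_shift_scale R s) (@continuous_left_vec s i).
  exact.
apply: cvgM.
  rewrite /tilt_num bilinear_entry.
  apply: cvg_sumr => i; apply: cvg_sumr => j.
  apply: cvgM; last exact: cvg_cst.
  apply: cvgM; first exact: cvga.
  have /cvg_ex[/= l dl] := @ex_derive _ _ _ _ _ _ _ (is_derive_tilted s i j).
  have := @derive_val _ _ _ _ _ _ _ (is_derive_tilted s i j).
  by rewrite /derive (cvg_lim _ dl)//= [X in _ --> X]mxE => <-.
apply: cvgV; first exact: D0.
under eq_fun do rewrite mxE; rewrite mxE.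
by apply: cvg_sumr => i; apply: cvgM; [exact: cvga|exact: cvg_cst].
Qed.

(** Differentiability comes from [lam]. The value for arbitrary positive eigenvectors comes from the
    tangent inequality: subtracting the line of slope [q] leaves a function with a minimum at
    [s]. *)
Lemma is_derive_log_lambda s a b :
  (forall i, 0 < a 0 i) -> (forall i, 0 < b i 0) ->
  a *m tilted P s = lam s *: a -> tilted P s *m b = lam s *: b ->
  is_derive s 1 (log_lambda P) (tilt_num s a b / (a *m tilted P s *m b) 0 0).
Proof.
move=> a0 b0 aA Ab.
pose r := tilt_num s (left_vec s) (right_vec s) / (left_vec s *m right_vec s) 0 0.
have dr : is_derive s 1 (log_lambda P) ((lam s)^-1 * r).
  exact: (is_derive1_comp (is_derive1_ln (lam_gt0 s)) (is_derive_lam s)).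
pose q := tilt_num s a b / (a *m tilted P s *m b) 0 0; rewrite -/q.
have D0 : 0 < (a *m tilted P s *m b) 0 0.
  rewrite aA -scalemxAl mxE mulr_gt0 ?lam_gt0// mxE.
  by apply: sumr_ord_gt0 => // i; rewrite mulr_gt0.
pose f t := log_lambda P t - t * q.
have df t l : is_derive t 1 (log_lambda P) l -> is_derive t 1 f (l - q).
  move=> dl; apply: is_deriveB; apply: is_derive_eq.
  by rewrite scaler0 add0r /GRing.scale/= mulr1.
have f0 : is_derive s 1 f 0.
  apply: (@derive1_at_min _ f (s - 1) (s + 1)).
  - by rewrite lerD2l (le_trans (lerN10 _))// ler01.
  - move=> t _; apply: (@ex_derive _ _ _ _ _ _ _ (df t _ _)).
    exact: (is_derive1_comp (is_derive1_ln (lam_gt0 t)) (is_derive_lam t)).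
  - by rewrite in_itv/= ltrBlDr ltrDl ltr01.
  - move=> t _; rewrite /f -subr_ge0.
    have -> : log_lambda P t - t * q - (log_lambda P s - s * q) =
        log_lambda P t - log_lambda P s - (t - s) * q.
      by move: (log_lambda P t) (log_lambda P s) => *; ring.
    by rewrite subr_ge0 /q mulrA ler_pdivrMr//; exact: log_lambda_tangent.
have := @derive_val _ _ _ _ _ _ _ f0.
rewrite (@derive_val _ _ _ _ _ _ _ (df _ _ dr)) => /subr0_eq <-.
exact: dr.
Qed.

End TiltedMatrices.

(** * Parametrization by tangents of a convex function *)

Section LegendreParametrization.
Context {R : realType}.
Variables (L r : R -> R) (H : R).
Hypothesis dL : forall t : R, is_derive t 1 L (r t).
Hypothesis tangentL : forall s t, (t - s) * r s <= L t - L s.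
Hypotheses (L1 : L 1 = 0) (r1 : r 1 = - H) (H0 : 0 <= H).
Implicit Types (s t c : R).

Definition tangent_intercept t := L t - t * r t.
Local Notation g := tangent_intercept.
(** With [log_lambda P] for [L] and [rho P] for [r], this and the next definition unfold to
    [beta_param] and [chi_param]. *)
Definition legendre_beta t := Num.sqrt 2 / t * Num.sqrt (L t - t * r t).
Definition legendre_chi t := (1 - 2 * t) / t ^+ 2 * L t - (1 - t) / t * r t.
Local Notation beta := legendre_beta.
Local Notation chi := legendre_chi.

(** Adding the tangent inequalities at [s] and [t] shows that [r] is nondecreasing; the tangent at
    [t], evaluated at [s], then gives [g t <= L s - s * r t <= g s]. *)
Lemma tangent_intercept_le s t : 0 < s -> s <= t -> g t <= g s.
Proof.
move=> s0 st; rewrite /g.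
have /(ler_wpM2l (ltW s0)) : r s <= r t.
  move: st; rewrite le_eqVlt => /predU1P[->//|st].
  rewrite -(@ler_pM2l _ (t - s)) ?subr_gt0//.
  by have := tangentL s t; have := tangentL t s; nra.
by have := tangentL t s; nra.
Qed.

Lemma tangent_intercept1 : g 1 = H.
Proof. by rewrite /g L1 r1 mul1r sub0r opprK. Qed.

Lemma tangent_intercept_ge t : 0 < t <= 1 -> H <= g t.
Proof. by move=> /andP[t0 t1]; rewrite -tangent_intercept1 tangent_intercept_le. Qed.

(* By [betaE] and [chiE], this function is stationary where [beta t ^+ 2 / 2 = c],
   and its value there is [c - chi t]. *)
Lemma is_derive_slope c t : 0 < t ->
  is_derive t 1 (fun u => L u / u + u * c) (c - g t / t ^+ 2).
Proof.
move=> t0.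
have tn0 : t != 0 by rewrite gt_eqF.
have dV : is_derive t 1 (fun u : R => u^-1) (- t ^- 2).
  apply: is_derive_eq (is_deriveV tn0 (is_derive_id t 1)) _.
  by rewrite /GRing.scale/= mulr1.
have dc : is_derive t 1 (fun u : R => u * c) c.
  by apply: is_derive_eq; rewrite scaler0 add0r /GRing.scale/= mulr1.
have dLt := dL t.
have dM : is_derive t 1 (fun u => L u * u^-1) (L t * - t ^- 2 + t^-1 * r t).
  by apply: is_deriveM.
apply: is_derive_eq.
by rewrite /g; field.
Qed.

Lemma continuous_slope c a b : 0 < a ->
  {within `[a, b], continuous (fun u => L u / u + u * c)}.
Proof.
move=> a0; apply: derivable_within_continuous => u; rewrite in_itv/= => /andP[au _].
by apply: (@ex_derive _ _ _ _ _ _ _ (is_derive_slope c _)); exact: lt_le_trans au.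
Qed.

Lemma betaE t : 0 < t <= 1 -> beta t ^+ 2 / 2 = g t / t ^+ 2.
Proof.
move=> t01; have /andP[t0 _] := t01; have tn0 : t != 0 by rewrite gt_eqF.
rewrite /legendre_beta exprMn expr_div_n !sqr_sqrtr//; last first.
  exact: le_trans H0 (tangent_intercept_ge t01).
by rewrite -/(g t); field.
Qed.

Lemma chiE t : 0 < t <= 1 -> chi t = (1 - t) * (beta t ^+ 2 / 2) - L t / t.
Proof.
move=> t01; rewrite betaE// /legendre_chi /g; have /andP[/lt0r_neq0 tn0 _] := t01.
by field.
Qed.

(** Makes [chi] a function of [beta]. The quotient [g u / u ^+ 2] is nonincreasing, so if it agrees
    at [s] and [t] it is constant between them; then [L u / u + u * c] takes the same value at [s]
    and [t], and this value determines [chi]. *)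
Lemma chi_beta_inj s t : 0 < s <= 1 -> 0 < t <= 1 -> beta s = beta t -> chi s = chi t.
Proof.
wlog st : s t / s <= t.
  by move=> W s01 t01 bst; have [/W->//|/ltW/W->] := leP s t.
move=> s01 t01 bst; move: st; rewrite le_eqVlt => /predU1P[->//|st].
have /andP[s0 s1] := s01; have /andP[t0 t1] := t01.
pose c := beta t ^+ 2 / 2.
have cs : g s / s ^+ 2 = c by rewrite -betaE// bst.
have ct : g t / t ^+ 2 = c by rewrite -betaE.
have d0 u : u \in `]s, t[ -> is_derive u 1 (fun u => L u / u + u * c) 0.
  rewrite in_itv/= => /andP[su ut]; have u0 := lt_trans s0 su.
  suff <- : c - g u / u ^+ 2 = 0 by exact: is_derive_slope.
  apply/eqP; rewrite subr_eq0 eq_le -{1}ct -cs.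
  have gu : 0 <= g u.
    by apply: le_trans H0 _; apply: tangent_intercept_ge; rewrite u0 (le_trans (ltW ut)).
  have gle v w : 0 < v -> v <= w -> 0 <= g w -> g w / w ^+ 2 <= g v / v ^+ 2.
    move=> v0 vw gw; have w0 := lt_le_trans v0 vw.
    rewrite ler_pdivrMr ?exprn_gt0// mulrAC ler_pdivlMr ?exprn_gt0//.
    apply: ler_pM; rewrite ?exprn_ge0 ?(ltW v0) ?tangent_intercept_le//.
    by rewrite ler_pXn2r ?nnegrE ?(ltW v0) ?(ltW w0).
  rewrite !gle ?(ltW su) ?(ltW ut)//.
  by apply: le_trans H0 _; exact: tangent_intercept_ge.
have [x _] := MVT st d0 (@continuous_slope c _ _ s0).
rewrite mul0r => /eqP; rewrite subr_eq0 => /eqP hst.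
rewrite !chiE// bst -/c.
rewrite (_ : (1 - s) * c - L s / s = c - (L s / s + s * c)); last by ring.
by rewrite -hst; ring.
Qed.

Lemma beta_ge t : 0 < t <= 1 -> Num.sqrt (2 * H) <= beta t.
Proof.
move=> t01; have /andP[t0 t1] := t01.
rewrite sqrtrM// /legendre_beta mulrAC ler_pdivlMr// -[leLHS]mulrA ler_wpM2l ?sqrtr_ge0//.
apply: (@le_trans _ _ (Num.sqrt H)); first by rewrite ler_piMr ?sqrtr_ge0.
by rewrite ler_wsqrtr//; exact: tangent_intercept_ge.
Qed.

(** The equation [g t / t ^+ 2 = c] says that [t] is a critical point of [h u = L u / u + u * c]. It
    is solved by minimizing [h] on [[e / 2, 2]] and excluding both endpoints. *)
Lemma beta_surj x : 0 < H -> Num.sqrt (2 * H) <= x -> exists2 t, 0 < t <= 1 & beta t = x.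
Proof.
move=> Hgt0 Hx.
have x0 : 0 <= x by apply: le_trans Hx; exact: sqrtr_ge0.
pose c := x ^+ 2 / 2.
have Hc : H <= c.
  rewrite /c ler_pdivlMr// mulrC -[leLHS]sqr_sqrtr ?mulr_ge0//.
  by rewrite ler_pXn2r ?nnegrE ?sqrtr_ge0.
suff [t t01 gt] : exists2 t, 0 < t <= 1 & g t / t ^+ 2 = c.
  exists t => //; apply/eqP.
  rewrite -(@eqrXn2 _ 2)// ?mulr_ge0 ?divr_ge0 ?sqrtr_ge0//; last by rewrite invr_ge0; case/andP: t01 => /ltW.
  by apply/eqP/(@mulIf _ 2^-1); rewrite ?invr_neq0// betaE.
move: Hc; rewrite le_eqVlt => /predU1P[<-|Hc].
  by exists 1; rewrite ?ltr01 ?lexx// expr1n divr1 tangent_intercept1.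
have c0 : 0 < c by exact: lt_trans Hc.
(* For [u < e < 1] one has [c * u ^+ 2 < c * e = H <= g u], so [h] decreases to the left of [e]. *)
pose e := H / c.
have e0 : 0 < e by rewrite divr_gt0.
have e1 : e < 1 by rewrite ltr_pdivrMr// mul1r.
pose h u := L u / u + u * c.
have lte : h e < h (e / 2).
  have e20 : 0 < e / 2 by rewrite divr_gt0.
  have ee : e / 2 < e by rewrite ltr_pdivrMr// ltr_pMr// ltr1n.
  have dh u : u \in `]e / 2, e[ -> is_derive u 1 h (c - g u / u ^+ 2).
    by rewrite in_itv/= => /andP[eu _]; apply: is_derive_slope; exact: lt_trans eu.
  have [u] := MVT ee dh (@continuous_slope c _ _ e20).
  rewrite in_itv/= => /andP[eu ue] hE.
  have u0 : 0 < u by exact: lt_trans eu.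
  rewrite -subr_lt0 hE nmulr_rlt0 ?subr_gt0// subr_lt0 ltr_pdivlMr ?exprn_gt0//.
  have ceH : c * e = H by rewrite /e mulrC divfK// gt_eqF.
  have : H <= g u by rewrite tangent_intercept_ge// u0 ltW// (lt_trans ue).
  have u1 : u < 1 by exact: lt_trans e1.
  by apply: lt_le_trans; rewrite -[ltRHS]ceH ltr_pM2l//; nra.
(* Beyond 1, [g u <= H < c < c * u ^+ 2], so [h] increases. *)
have lt2 : h 1 < h 2.
  have dh (u : R) : u \in `]1, 2[ -> is_derive u 1 h (c - g u / u ^+ 2).
    by rewrite in_itv/= => /andP[eu _]; apply: is_derive_slope; exact: lt_trans eu.
  have [|u] := MVT _ dh (@continuous_slope c _ _ ltr01); first by rewrite ltr1n.
  rewrite in_itv/= => /andP[u1 _] hE.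
  rewrite -subr_gt0 hE mulr_gt0 ?subr_gt0 ?ltr1n//.
  rewrite ltr_pdivrMr ?exprn_gt0 ?(lt_trans _ u1)//.
  have : g u <= H by rewrite -tangent_intercept1 tangent_intercept_le// ltW.
  by move=> /le_lt_trans; apply; rewrite (lt_trans Hc)// ltr_pMr// exprn_egt1.
have e22 : e / 2 <= 2 by lra.
have [t] := EVT_min e22 (@continuous_slope c _ _ (divr_gt0 e0 (ltr0Sn R 1))).
rewrite in_itv/= => /andP[et t2] tmin; rewrite -/h in tmin.
have {}et : e / 2 < t.
  rewrite lt_neqAle et andbT; apply/eqP => ett; move: lte; rewrite ett ltNge => /negP; apply.
  by apply: tmin; rewrite in_itv/=; apply/andP; split; lra.
have {}t2 : t < 2.
  rewrite lt_neqAle t2 andbT; apply/eqP => ett; move: lt2; rewrite -ett ltNge => /negP; apply.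
  by apply: tmin; rewrite in_itv/=; apply/andP; split; lra.
have t0 : 0 < t by lra.
have d0 : is_derive t 1 h 0.
  apply: (@derive1_at_min _ h (e / 2) 2) => //.
  - move=> u; rewrite in_itv/= => /andP[eu _].
    by apply: (@ex_derive _ _ _ _ _ _ _ (is_derive_slope c _)); lra.
  - by rewrite in_itv/= et.
  - move=> u; rewrite in_itv/= => /andP[eu u2]; apply: tmin.
    by rewrite in_itv/= !ltW.
have := @derive_val _ _ _ _ _ _ _ d0.
rewrite (@derive_val _ _ _ _ _ _ _ (is_derive_slope c t0)) => /subr0_eq cE.
(* A critical point beyond 1 would give [c * t ^+ 2 = g t <= H < c]. *)
exists t => //; rewrite t0 leNgt; apply/negP => t1.
have : g t <= H by rewrite -tangent_intercept1 tangent_intercept_le// ltW.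
have -> : g t = c * t ^+ 2 by rewrite cE divfK// gt_eqF// exprn_gt0.
by rewrite leNgt (lt_trans Hc)// ltr_pMr// exprn_egt1.
Qed.

End LegendreParametrization.

(** * Entropy rate *)

Section EntropyRate.
Context {R : realType} {M : nat}.
Variables (P : 'M[R]_M) (pi : 'rV[R]_M).
Hypotheses (hP : stochastic P) (irrP : irreducible_chain P).
Hypothesis hpi : stationary_distribution P pi.

Lemma stationary_size_gt0 : (0 < M)%N.
Proof.
case: hpi => _ pi1 _; rewrite lt0n; apply/negP => /eqP M0.
move: pi1; rewrite big1 => [/eqP|[i iM]]; first by rewrite eq_sym oner_eq0.
by exfalso; move: iM; rewrite M0.
Qed.
Let M0 := stationary_size_gt0.

Lemma stochastic_le1 i j : P i j <= 1.
Proof. by case: hP => P0 P1; rewrite -(P1 i) (bigD1 j)//= lerDl sumr_ge0. Qed.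

Lemma stationary_gt0 i : 0 < pi 0 i.
Proof.
case: hpi => pi0 pi1 piP.
apply: (@irreducible_eigen_gt0 _ _ P pi 1) => //; rewrite ?scale1r//.
- by case: hP.
- by move=> k j; rewrite (ord1 k).
- apply: contra_eq_neq pi1 => ->; rewrite big1 1?eq_sym ?oner_eq0// => k _.
  by rewrite mxE.
Qed.

Lemma mulmx_ones : P *m const_mx 1 = const_mx 1 :> 'cV[R]_M.
Proof.
case: hP => _ P1; apply/colP => i; rewrite !mxE -[RHS](P1 i).
by apply: eq_bigr => j _; rewrite mxE mulr1.
Qed.

(** [pi] and the all-ones column are positive eigenvectors of [P] with eigenvalue 1. *)
Lemma lam1 : lam P 1 = 1.
Proof.
case: hpi => _ _ piP; case: (hP) => P0 _.
apply: (@lambda_maxE _ _ _ pi (const_mx 1)) => //; rewrite ?(tilted1 hP) ?scale1r//.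
- exact: stationary_gt0.
- by move=> i; rewrite mxE ltr01.
- exact: mulmx_ones.
Qed.

Lemma log_lambda1 : log_lambda P 1 = 0.
Proof. by rewrite /log_lambda -/(lam P 1) lam1 ln1. Qed.

Lemma is_derive_rho (t : R) : is_derive t 1 (log_lambda P) (rho P t).
Proof.
pose d := is_derive_log_lambda hP irrP M0 (left_vec_gt0 hP irrP M0 t)
  (right_vec_gt0 hP irrP M0 t) (left_vecE hP irrP M0 t) (right_vecE hP irrP M0 t).
by split; [exact: (@ex_derive _ _ _ _ _ _ _ d)|rewrite /rho derive1E].
Qed.

Lemma rhoE t (a : 'rV[R]_M) (b : 'cV[R]_M) :
  (forall i, 0 < a 0 i) -> (forall i, 0 < b i 0) ->
  a *m tilted P t = lam P t *: a -> tilted P t *m b = lam P t *: b ->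
  rho P t = tilt_num P t a b / (a *m tilted P t *m b) 0 0.
Proof.
move=> a0 b0 aA Ab; rewrite /rho derive1E.
exact: (@derive_val _ _ _ _ _ _ _ (is_derive_log_lambda hP irrP M0 a0 b0 aA Ab)).
Qed.

Lemma log_lambda_subgradient s t :
  (t - s) * rho P s <= log_lambda P t - log_lambda P s.
Proof.
have a0 := left_vec_gt0 hP irrP M0 s; have b0 := right_vec_gt0 hP irrP M0 s.
have aA := left_vecE hP irrP M0 s; have Ab := right_vecE hP irrP M0 s.
rewrite (rhoE a0 b0 aA Ab) mulrA ler_pdivrMr; first exact: log_lambda_tangent.
rewrite aA -scalemxAl mxE mulr_gt0 ?lam_gt0// mxE.
by apply: sumr_ord_gt0 => // i; rewrite mulr_gt0.
Qed.

Lemma log_mxE i j : P i j * log_mx P i j = P i j * ln (P i j).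
Proof. by rewrite mxE; case: eqP => // ->; rewrite !mul0r. Qed.

(** The formula for [rho] is evaluated on [pi] and the all-ones column, whose pairing is 1. *)
Lemma rho1 : rho P 1 = - entropy_rate P pi.
Proof.
case: hpi => pi0 pi1 piP.
rewrite (@rhoE 1 pi (const_mx 1)).
  rewrite /tilt_num (tilted1 hP) [pi *m P]piP.
  have -> : (pi *m (const_mx 1 : 'cV[R]_M)) 0 0 = 1.
    by rewrite mxE -[RHS]pi1; apply: eq_bigr => i _; rewrite mxE mulr1.
  rewrite divr1 bilinear_entry /entropy_rate opprK; apply: eq_bigr => i _.
  rewrite mulr_sumr; apply: eq_bigr => j _.
  by rewrite [const_mx _ _ _]mxE mulr1 [map2_mx _ _ _ _ _]mxE [log_mx P i j * _]mulrC log_mxE.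
- exact: stationary_gt0.
- by move=> i; rewrite mxE ltr01.
- by rewrite (tilted1 hP) lam1 scale1r.
- by rewrite (tilted1 hP) lam1 scale1r mulmx_ones.
Qed.

Let term_ge0 i j : 0 <= - (pi 0 i * (P i j * ln (P i j))).
Proof.
case: hP => P0 _; case: hpi => pi0 _ _.
by rewrite -!mulrN !mulr_ge0// oppr_ge0 ln_le0// stochastic_le1.
Qed.

Let entropyE : entropy_rate P pi = \sum_i \sum_j - (pi 0 i * (P i j * ln (P i j))).
Proof.
rewrite /entropy_rate -sumrN; apply: eq_bigr => i _.
by rewrite mulr_sumr sumrN.
Qed.

Lemma entropy_rate_ge0 : 0 <= entropy_rate P pi.
Proof. by rewrite entropyE; apply: sumr_ge0 => i _; apply: sumr_ge0. Qed.

Lemma entropy_rate_eq0 i j : entropy_rate P pi = 0 -> P i j = 0 \/ P i j = 1.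
Proof.
rewrite entropyE => /eqP; rewrite psumr_eq0; last by move=> k _; apply: sumr_ge0.
move=> /allP/(_ i (mem_index_enum i)); rewrite /= psumr_eq0// => /allP/(_ j (mem_index_enum j)).
rewrite /= oppr_eq0 !mulf_eq0 gt_eqF ?stationary_gt0//= => /orP[/eqP|]; first by left.
move=> lnP; case: hP => P0 _; have [|Pij] := eqVneq (P i j) 0; first by left.
by right; apply/eqP; rewrite -ln_eq0// lt0r Pij P0.
Qed.

(* A chain without entropy is a deterministic cycle, whose period is its length. *)
Lemma entropy_rate_gt0 : aperiodic_chain P -> (1 < M)%N -> 0 < entropy_rate P pi.
Proof.
move=> aperP M1; rewrite lt0r entropy_rate_ge0 andbT; apply/negP => /eqP H0.
have P01 i j := entropy_rate_eq0 i j H0; case: (hP) => P0 P1.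
have [f Pf] : {f : 'I_M -> 'I_M & forall i, P i (f i) = 1}.
  suff fex i : exists j, P i j = 1.
    by exists (fun i => sval (cid (fex i))) => i; case: cid.
  apply: contrapT => /forallNP Pn; have := P1 i; rewrite big1 => [/eqP|j _].
    by rewrite eq_sym oner_eq0.
  by have [|/Pn] := P01 i j.
have PfE i j : P i j = (j == f i)%:R.
  case: eqP => [->//|/eqP ji]; have [//|Pij] := P01 i j.
  have := P1 i; rewrite (bigD1 (f i))//= (bigD1 j)//= Pf Pij addrA => /eqP.
  rewrite gt_eqF// ltr_wpDr ?sumr_ge0// ltrDl; exact: ltr01.
have PkE k i j : (P ^+ k) i j = (j == iter k f i)%:R.
  elim: k j => [|k IH] j; first by rewrite expr0 mxE eq_sym.
  rewrite exprSr mxE (bigD1 (iter k f i))//= IH eqxx mul1r PfE big1 ?addr0// => l /negbTE lk.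
  by rewrite IH lk mul0r.
have reach i j : exists k, iter k f i = j.
  have [k] := irrP i j; rewrite PkE; case: eqP => [->|]; last by rewrite ltxx.
  by exists k.
pose i := Ordinal M0; pose j := Ordinal M1.
have ij : i != j by [].
have [k1 k1j] := reach i j; have [k2 k2i] := reach j i.
have ex : exists d, (0 < d)%N && (iter d f i == i).
  exists (k2 + k1)%N; rewrite iterD k1j k2i eqxx andbT addn_gt0 orbC.
  by case: k1 k1j => // ijE; rewrite -ijE eqxx in ij.
have [d /andP[d0 /eqP di] dmin] := ex_minnP ex.
(* Modulo the least return time [d], any other return time leaves a remainder that would be a
   shorter one, so [d] divides them all and aperiodicity forces [d = 1]. Then [i] is fixed by [f]
   and never reaches [j]. *)
have d1 : d = 1%N.
  apply: (aperP i) => k k0; rewrite PkE.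
  case: eqP => [ki _|]; last by rewrite ltxx.
  have iterM q : iter (q * d) f i = i by elim: q => // q IH; rewrite mulSn iterD IH.
  move: ki; rewrite {1}(divn_eq k d) addnC iterD iterM => ki.
  rewrite /dvdn eqn0Ngt; apply/negP => r0.
  have := dmin (k %% d)%N; rewrite r0 -ki eqxx => /(_ erefl).
  by rewrite leqNgt ltn_pmod.
have fi : f i = i by move: di; rewrite d1.
by move: ij; rewrite -k1j iter_fix// eqxx.
Qed.

End EntropyRate.

(** * Densities of product laws *)

Section Density.
Local Open Scope ereal_scope.
Context {d} {T : measurableType d} {R : realType}.
Import HBNNSimple.

(** Stated on integrals rather than on sets, so that densities compose and pass through iterated
    integrals directly. *)
Definition has_density (mu nu : {measure set T -> \bar R}) (f : T -> R) : Prop :=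
  [/\ measurable_fun [set: T] f, (forall x, (0 <= f x)%R) &
    forall g : T -> \bar R, measurable_fun [set: T] g -> (forall x, 0 <= g x) ->
      \int[mu]_x g x = \int[nu]_x (g x * (f x)%:E)].

(** Both sides agree on simple functions by the hypothesis on their level sets; monotone convergence
    extends this to every nonnegative measurable [g]. *)
Lemma has_densityP (mu nu : {measure set T -> \bar R}) (f : T -> R) :
  measurable_fun [set: T] f -> (forall x, (0 <= f x)%R) ->
  (forall A, measurable A -> mu A = \int[nu]_(x in A) (f x)%:E) ->
  has_density mu nu f.
Proof.
move=> mf f0 muE; split=> // g mg g0.
pose h := nnsfun_approx measurableT mg.
have mEf : measurable_fun [set: T] (EFin \o f) by exact/measurable_EFinP.
have -> : \int[mu]_x g x = lim (\int[mu]_x (EFin \o h n) x @[n --> \oo]).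
  have gE x : g x = lim ((EFin \o h n) x @[n --> \oo]).
    by apply/esym/cvg_lim => //; exact: cvg_nnsfun_approx.
  under eq_integral => x _ do rewrite gE.
  apply: monotone_convergence => //.
  - by move=> n; exact/measurable_EFinP.
  - by move=> n x _; rewrite lee_fin.
  - by move=> x _ a b ab; rewrite lee_fin; exact/lefP/nd_nnsfun_approx.
have -> : \int[nu]_x (g x * (f x)%:E) =
    lim (\int[nu]_x ((EFin \o h n) x * (f x)%:E) @[n --> \oo]).
  have gE x : g x * (f x)%:E = lim ((EFin \o h n) x * (f x)%:E @[n --> \oo]).
    apply/esym/cvg_lim => //; apply: cvgeZr => //; exact: cvg_nnsfun_approx.
  under eq_integral => x _ do rewrite gE.
  apply: monotone_convergence => //.
  - by move=> n; apply: emeasurable_funM => //; exact/measurable_EFinP.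
  - by move=> n x _; rewrite mule_ge0 ?lee_fin.
  - move=> x _ a b ab; rewrite lee_wpmul2r ?lee_fin//.
    exact/lefP/nd_nnsfun_approx.
suff suf n : \int[mu]_x (EFin \o h n) x = \int[nu]_x ((EFin \o h n) x * (f x)%:E).
  by under eq_fun do rewrite suf.
have mh y : measurable (h n @^-1` [set y]) by exact: measurable_sfunP.
transitivity (\sum_(y \in range (h n)) y%:E * mu (h n @^-1` [set y])).
  by rewrite integralT_nnsfun sintegralE.
transitivity (\int[nu]_x \sum_(y \in range (h n))
    (y%:E * ((\1_(h n @^-1` [set y]) x)%:E * (f x)%:E))); last first.
  apply: eq_integral => x _.
  rewrite /= [in RHS]fimfunE -fsumEFin// ge0_mule_fsuml => [|y]; last first.
    exact: nnfun_muleindic_ge0.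
  by apply: eq_fsbigr => y _; rewrite EFinM muleA.
rewrite ge0_integral_fsum//; last 2 first.
- move=> y; apply: emeasurable_funM => //; apply: emeasurable_funM => //.
  exact/measurable_EFinP/measurable_indic.
- by move=> y x _; have := nnfun_muleindic_ge0 (h n) y x; rewrite muleA => yx; rewrite mule_ge0 ?lee_fin.
apply: eq_fsbigr => y; rewrite inE => -[t _ <-].
rewrite ge0_integralZl ?lee_fin//; last 2 first.
- by apply: emeasurable_funM => //; exact/measurable_EFinP/measurable_indic.
- by move=> x _; rewrite mule_ge0 ?lee_fin.
congr (_ * _); rewrite muE// integral_mkcond.
by apply: eq_integral => x _; rewrite epatch_indic muleC.
Qed.

Lemma has_density_measureE (mu nu : {measure set T -> \bar R}) (f : T -> R) A :
  has_density mu nu f -> measurable A -> mu A = \int[nu]_(x in A) (f x)%:E.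
Proof.
move=> [mf f0 muE] mA.
have -> : mu A = \int[mu]_x (\1_A x)%:E by rewrite integral_indic// setIT.
rewrite muE//; last first.
  exact/measurable_EFinP/measurable_indic.
by rewrite [RHS]integral_mkcond; apply: eq_integral => x _; rewrite epatch_indic muleC.
Qed.

(** Turns the densities of two laws against a common measure, such as Lebesgue measure, into their
    likelihood ratio. *)
Lemma has_density_trans (mu nu rho : {measure set T -> \bar R}) (f g h : T -> R) :
  measurable_fun [set: T] f -> (forall x, (0 <= f x)%R) ->
  has_density mu rho g -> has_density nu rho h -> (forall x, g x = (f x * h x)%R) ->
  has_density mu nu f.
Proof.
move=> mf f0 [mg g0 muE] [mh h0 nuE] gE; split=> // u mu_ u0.
rewrite muE// nuE//.
- by apply: eq_integral => x _; rewrite gE EFinM muleA.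
- by apply: emeasurable_funM => //; exact/measurable_EFinP.
- by move=> x; rewrite mule_ge0 ?lee_fin.
Qed.

Lemma has_density_null (mu nu : {measure set T -> \bar R}) (f : T -> R) A :
  has_density mu nu f -> (forall x, (0 < f x)%R) -> measurable A -> mu A = 0 -> nu A = 0.
Proof.
move=> dens fgt0 mA; rewrite (has_density_measureE dens mA) => int0.
have [mf _ _] := dens.
have mfA : measurable_fun A (EFin \o f) by apply: measurable_funTS; exact/measurable_EFinP.
have [+ _] := ae_eq_integral_abs nu mA mfA.
have -> : \int[nu]_(x in A) `|(EFin \o f) x| = 0.
  by rewrite -int0; apply: eq_integral => x _; rewrite /= ger0_norm// ltW.
move=> /(_ erefl) f_eq0; apply: measure_negligible => //.
apply: negligibleS f_eq0 => x Ax /= /(_ Ax) /eqP.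
by rewrite eqe gt_eqF.
Qed.

End Density.

Section TupleDensity.
Local Open Scope ereal_scope.
Context {d} {T : measurableType d} {R : realType}.

(** Induction on the length by Tonelli: for a fixed first coordinate the induction hypothesis
    changes the law of the tail, then the first density changes the outer integral. *)
Lemma tuple_law_density n (mu nu : 'I_n -> probability T R) (f : 'I_n -> T -> R) :
  (forall i, has_density (mu i) (nu i) (f i)) ->
  has_density (tuple_law mu) (tuple_law nu)
    (fun y : n.-tuple T => \prod_(i < n) f i (tnth y i))%R.
Proof.
elim: n mu nu f => [|n IH] mu nu f dens.
  split.
  - by under eq_fun do rewrite big_ord0; exact: measurable_cst.
  - by move=> x; rewrite big_ord0 ler01.
  - by move=> g mg g0; apply: eq_integral => x _; rewrite big_ord0 mule1.
have [mF F0 FE] := IH _ _ _ (fun i => dens (lift ord0 i)).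
have [mf0 f00 f0E] := dens ord0.
have mprod : measurable_fun setT (fun y : n.+1.-tuple T => \prod_(i < n.+1) f i (tnth y i))%R.
  apply: measurable_prod => i _.
  have [mfi _ _] := dens i.
  by apply: measurableT_comp => //; exact: measurable_tnth.
split=> //.
- by move=> y; apply: prodr_ge0 => i _; have [_ ? _] := dens i.
move=> g mg g0.
have mgc : measurable_fun setT (fun z : T * n.-tuple T => g (cons_pair z)).
  by apply: measurableT_comp => //; exact: measurable_cons_pair.
have mh : measurable_fun setT
    (fun y : n.+1.-tuple T => g y * (\prod_(i < n.+1) f i (tnth y i))%:E).
  by apply: emeasurable_funM => //; exact/measurable_EFinP.
rewrite /= ge0_integral_distribution//=.
rewrite ge0_integral_distribution//=; last first.
- by move=> y; rewrite mule_ge0// lee_fin; apply: prodr_ge0 => i _; have [_ ? _] := dens i.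
rewrite fubini_tonelli1// fubini_tonelli1; last 2 first.
- exact: (measurableT_comp mh (@measurable_cons_pair _ _ n)).
- by move=> z /=; rewrite mule_ge0// lee_fin; apply: prodr_ge0 => i _; have [_ ? _] := dens i.
pose G x := \int[tuple_law (fun i => nu (lift ord0 i))]_y
  (g (cons_pair (x, y)) * (\prod_(i < n) f (lift ord0 i) (tnth y i))%:E).
have mgy x : measurable_fun setT (fun y : n.-tuple T => g (cons_pair (x, y))).
  exact: (measurableT_comp mgc (measurable_pair1 x)).
have mGxy : measurable_fun setT (fun z : T * n.-tuple T =>
    g (cons_pair z) * (\prod_(i < n) f (lift ord0 i) (tnth z.2 i))%:E).
  apply: emeasurable_funM => //; apply/measurable_EFinP.
  exact: (measurableT_comp mF measurable_snd).
have G0 x : 0 <= G x.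
  by apply: integral_ge0 => y _; rewrite mule_ge0// lee_fin.
transitivity (\int[mu ord0]_x G x).
  by apply: eq_integral => x _; rewrite /fubini_F /G FE.
have mG : measurable_fun setT G.
  have Gxy0 (z : T * n.-tuple T) :
      0 <= g (cons_pair z) * (\prod_(i < n) f (lift ord0 i) (tnth z.2 i))%:E.
    by rewrite mule_ge0// lee_fin.
  exact: (measurable_fun_fubini_tonelli_F (m2 := tuple_law (fun i => nu (lift ord0 i))) _ mGxy Gxy0).
rewrite f0E//.
apply: eq_integral => x _; rewrite /fubini_F /G muleC.
rewrite -ge0_integralZl ?lee_fin//; last 2 first.
- apply: emeasurable_funM => //; exact/measurable_EFinP.
- by move=> y _; rewrite mule_ge0// lee_fin.
apply: eq_integral => y _ /=.
rewrite big_ord_recl muleCA EFinM tnth0; congr (_ * (_ * _%:E)).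
by apply: eq_bigr => i _; rewrite tnthS.
Qed.

End TupleDensity.

(** * Gaussian likelihood ratios and path sums *)

Section GaussianLikelihood.
Context {R : realType} {M : nat}.
Local Notation observation N := (N.-tuple (M.-tuple (measurableTypeR R))).

(** The density of N(m, 1) with respect to N(0, 1). *)
Definition gaussian_ratio (m x : R) : R := expR (m * x - m ^+ 2 / 2).

Lemma measurable_gaussian_ratio m :
  measurable_fun [set: measurableTypeR R] (gaussian_ratio m).
Proof.
apply: measurableT_comp => //; apply: measurable_funB => //.
Qed.

Lemma normal_prob_density m :
  has_density (normal_prob m 1) (normal_prob 0 1) (gaussian_ratio m).
Proof.
have pdfD (a : R) : has_density (normal_prob a 1) lebesgue_measure (normal_pdf a 1).
  apply: has_densityP => //; first exact: measurable_normal_pdf.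
  by move=> x; exact: normal_pdf_ge0.
apply: has_density_trans (pdfD m) (pdfD 0) _.
- exact: measurable_gaussian_ratio.
- by move=> x; exact: expR_ge0.
- move=> x; rewrite !normal_pdfE ?oner_neq0// /normal_fun mulrCA -expRD.
  by congr (_ * expR _); rewrite subr0 expr1n; field.
Qed.

Definition likelihood N (mean : 'I_M -> 'I_N -> R) (y : observation N) : R :=
  \prod_(n < N) \prod_(m < M) gaussian_ratio (mean m n) (tnth (tnth y n) m).

Lemma gaussian_law_density N (mean : 'I_M -> 'I_N -> R) :
  has_density (gaussian_law mean) (law_H0 N) (likelihood mean).
Proof.
exact: (tuple_law_density (fun n => tuple_law_density (fun m =>
  normal_prob_density (mean m n)))).
Qed.

Lemma likelihood_gt0 N (mean : 'I_M -> 'I_N -> R) y : 0 < likelihood mean y.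
Proof. by apply: prodr_gt0 => n _; apply: prodr_gt0 => m _; exact: expR_gt0. Qed.

Lemma likelihoodE N (mean : 'I_M -> 'I_N -> R) y : likelihood mean y =
  expR (\sum_(n < N) \sum_(m < M) (mean m n * tnth (tnth y n) m - mean m n ^+ 2 / 2)).
Proof.
by rewrite expR_sum; apply: eq_bigr => n _; rewrite expR_sum.
Qed.

(** The exponent [t * (m * x - m ^+ 2 / 2)] is the one for mean [t * m] plus the constant
    [(t ^+ 2 - t) / 2 * m ^+ 2]. This reduces the moment of order [t] under H0 to the total mass of
    another Gaussian law. *)
Lemma likelihood_powR N (mean : 'I_M -> 'I_N -> R) (t : R) y :
  likelihood mean y `^ t =
  expR ((t ^+ 2 - t) / 2 * \sum_(n < N) \sum_(m < M) mean m n ^+ 2) *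
  likelihood (fun m n => t * mean m n) y.
Proof.
rewrite !likelihoodE -expRM -expRD; congr expR.
rewrite mulr_suml mulr_sumr -big_split /=; apply: eq_bigr => n _.
rewrite mulr_suml mulr_sumr -big_split /=; apply: eq_bigr => m _.
by field.
Qed.

Lemma measurable_likelihood N (mean : 'I_M -> 'I_N -> R) :
  measurable_fun setT (likelihood mean).
Proof. by case: (gaussian_law_density mean). Qed.

Lemma integral_likelihood_powR N (mean : 'I_M -> 'I_N -> R) (t : R) :
  (\int[law_H0 N]_y ((likelihood mean y `^ t)%:E) =
   (expR ((t ^+ 2 - t) / 2 * \sum_(n < N) \sum_(m < M) mean m n ^+ 2))%:E)%E.
Proof.
under eq_integral do rewrite likelihood_powR EFinM.
rewrite ge0_integralZl ?lee_fin ?expR_ge0//; last 2 first.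
- by apply/measurable_EFinP; exact: measurable_likelihood.
- by move=> y _; rewrite lee_fin ltW// likelihood_gt0.
rewrite -[RHS]mule1; congr (_ * _)%E.
have := has_density_measureE (gaussian_law_density (fun m n => t * mean m n)) measurableT.
move=> <-; exact: (@probability_setT _ _ _ (gaussian_law (fun m n => t * mean m n))).
Qed.

End GaussianLikelihood.

(** Each [x i] is at most the power [t^-1] of [Z]. Split [x i] into its powers [t] and [1 - t],
    bound the second factor this way, and sum. *)
Lemma sumr_le_powR_sum (R : realType) (I : finType) (x : I -> R) (t : R) :
  0 < t <= 1 -> (forall i, 0 <= x i) ->
  \sum_i x i <= (\sum_i x i `^ t) `^ t^-1.
Proof.
move=> /andP[t0 t1] x0; pose Z := \sum_i x i `^ t; rewrite -/Z.
have Z0 : 0 <= Z by apply: sumr_ge0 => i _; exact: powR_ge0.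
have xZ i : x i <= Z `^ t^-1.
  rewrite -[leLHS](powRr1 (x0 i)) -(divff (lt0r_neq0 t0)) powRrM.
  rewrite ge0_ler_powR ?invr_ge0 ?nnegrE ?powR_ge0 ?(ltW t0)//.
  by rewrite /Z (bigD1 i)//= lerDl; apply: sumr_ge0 => j _; exact: powR_ge0.
have tE : t^-1 = 1 + t^-1 * (1 - t).
  by rewrite mulrBr mulr1 mulVf ?lt0r_neq0// addrC subrK.
rewrite [leRHS](_ : _ = Z * (Z `^ t^-1) `^ (1 - t)); last first.
  rewrite -powRrM [in LHS]tE powRD ?powRr1//.
  by rewrite -tE gt_eqF// invr_gt0.
rewrite /Z mulr_suml; apply: ler_sum => i _.
have := x0 i; rewrite le_eqVlt => /predU1P[<-|xi0].
  by rewrite powR0 ?mul0r// lt0r_neq0.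
rewrite -{1}[x i](powRr1 (x0 i)) -[X in x i `^ X](subrKC t) powRD; last first.
  by rewrite (gt_eqF xi0) implybT.
by rewrite ler_wpM2l ?powR_ge0// ge0_ler_powR ?nnegrE ?subr_ge0 ?powR_ge0.
Qed.

(** * Sums over paths as matrix powers *)

Section PathSums.
Context {R : realType} {M : nat}.

Definition ffun_cons (T : finType) n (i : T) (s : {ffun 'I_n -> T}) : {ffun 'I_n.+1 -> T} :=
  [ffun k => oapp s i (unlift ord0 k)].

Lemma ffun_cons0 (T : finType) n (i : T) (s : {ffun 'I_n -> T}) : ffun_cons i s ord0 = i.
Proof. by rewrite ffunE unlift_none. Qed.

Lemma ffun_consS (T : finType) n (i : T) (s : {ffun 'I_n -> T}) k :
  ffun_cons i s (lift ord0 k) = s k.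
Proof. by rewrite ffunE liftK. Qed.

Lemma big_ffun_cons (T : finType) n (F : {ffun 'I_n.+1 -> T} -> R) :
  \sum_s F s = \sum_i \sum_s F (ffun_cons i s).
Proof.
rewrite pair_big /= (reindex (fun z : T * {ffun 'I_n -> T} => ffun_cons z.1 z.2)) //.
exists (fun s : {ffun 'I_n.+1 -> T} => (s ord0, [ffun k : 'I_n => s (lift ord0 k)])) => [[i s] _|s _] /=.
  by rewrite ffun_cons0; congr (_, _); apply/ffunP => k; rewrite ffunE ffun_consS.
apply/ffunP => k; case: (unliftP ord0 k) => [j ->|->]; last by rewrite ffun_cons0.
by rewrite ffun_consS ffunE.
Qed.

(** Induction on the number of transitions: summing over the first state replaces the initial weight
    [u] by [u *m A] on the rest of the path. *)
Lemma sum_paths (A : 'M[R]_M) (b : 'cV[R]_M) N (u : 'rV[R]_M) :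
  \sum_(s : {ffun 'I_N.+1 -> 'I_M}) u 0 (s ord0) *
    (\prod_(n < N) A (s (widen_ord (leqnSn N) n)) (s (lift ord0 n))) * b (s ord_max) 0 =
  (u *m A ^+ N *m b) 0 0.
Proof.
elim: N u => [|N IH] u.
  rewrite expr0 mulmx1 mxE big_ffun_cons; apply: eq_bigr => i _.
  have -> : ord_max = ord0 :> 'I_1 by apply/val_inj.
  under eq_bigr do rewrite big_ord0 mulr1 ffun_cons0.
  by rewrite sumr_const card_ffun !card_ord expn0.
rewrite exprS mulmxA -IH big_ffun_cons exchange_big /=; apply: eq_bigr => s _.
rewrite mxE !mulr_suml; apply: eq_bigr => i _.
rewrite ffun_cons0 big_ord_recl ffun_consS.
have -> : ord_max = lift ord0 ord_max :> 'I_N.+2 by apply/val_inj.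
rewrite ffun_consS (_ : widen_ord _ ord0 = ord0); last exact/val_inj.
rewrite ffun_cons0 !mulrA; congr (_ * _ * _); apply: eq_bigr => k _.
rewrite ffun_consS (_ : widen_ord _ _ = lift ord0 (widen_ord (leqnSn N) k)) ?ffun_consS//.
exact/val_inj.
Qed.

Variables (P : 'M[R]_M) (pi : 'rV[R]_M).
Hypotheses (hP : stochastic P) (irrP : irreducible_chain P).
Hypothesis hpi : stationary_distribution P pi.

Lemma path_prob_ge0 N (s : {ffun 'I_N.+1 -> 'I_M}) : 0 <= path_prob P pi s.
Proof.
case: hpi => pi0 _ _; case: hP => P0 _.
by rewrite mulr_ge0// prodr_ge0.
Qed.

(** The sum is dominated by a path sum for [tilted P t] with the right Perron vector as terminal
    weight, which is a constant times [lam P t ^+ N]; a path of [N.+1] states has [N]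
    transitions. *)
Lemma path_prob_powR_le t : 0 < t -> exists2 C, 0 < C & forall N,
  \sum_(s : {ffun 'I_N.+1 -> 'I_M}) path_prob P pi s `^ t <= C * lam P t ^+ N.
Proof.
move=> t0; case: hpi => pi0 pi1 _; have [P0 P1] := hP.
have M0 := stationary_size_gt0 hpi.
pose b := right_vec hP irrP M0 t; have b0 i : 0 < b i 0 by exact: right_vec_gt0.
(* This choice makes [c * b i 0] at least 1 at every state, so it can be inserted as terminal
   weight. *)
pose c := \sum_i (b i 0)^-1.
have bc i : 1 <= c * b i 0.
  rewrite -ler_pdivrMr// mul1r /c (bigD1 i)//= lerDl; apply: sumr_ge0 => j _.
  by rewrite invr_ge0 ltW.
have c0 : 0 < c by apply: sumr_ord_gt0 => // i; rewrite invr_gt0.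
exists (c * \sum_i b i 0) => [|N].
  by rewrite mulr_gt0// sumr_ord_gt0.
have Ab : tilted P t ^+ N *m b = lam P t ^+ N *: b.
  elim: N => [|N IH]; first by rewrite !expr0 mul1mx scale1r.
  by rewrite exprSr -mulmxA right_vecE -scalemxAr IH scalerA -exprS.
have -> : c * (\sum_i b i 0) * lam P t ^+ N =
    c * ((const_mx 1 : 'rV_M) *m tilted P t ^+ N *m b) 0 0.
  rewrite -mulmxA Ab -scalemxAr mxE -mulrA; congr (_ * _).
  rewrite mulrC; congr (_ * _); rewrite mxE.
  by apply: eq_bigr => i _; rewrite mxE mul1r.
rewrite -sum_paths mulr_sumr; apply: ler_sum => s _.
rewrite mxE mul1r mulrCA.
have prodE : (\prod_(n < N) P (s (widen_ord (leqnSn N) n)) (s (lift ord0 n))) `^ t =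
    \prod_(n < N) tilted P t (s (widen_ord (leqnSn N) n)) (s (lift ord0 n)).
  (* Nonnegativity of the partial products is carried along, because splitting the power of a
     product uses it. *)
  apply: proj2; apply: (big_rec2 (fun x y => 0 <= x /\ x `^ t = y)).
    by rewrite ler01 powR1.
  move=> n x y _ [x0 <-]; rewrite powRM// mulr_ge0//; split=> //.
  by rewrite mxE; case: eqP => [->|//]; rewrite powR0// gt_eqF.
rewrite powRM ?prodr_ge0// prodE.
have prod0 : 0 <= \prod_(n < N) tilted P t (s (widen_ord (leqnSn N) n)) (s (lift ord0 n)).
  by apply: prodr_ge0 => n _; exact: nonneg_tilted.
rewrite mulrC ler_wpM2l//; apply: le_trans (bc _).
have pi_le1 : pi 0 (s ord0) <= 1.
  by rewrite -[leRHS]pi1 (bigD1 (s ord0))//= lerDl; apply: sumr_ge0.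
have -> : 1 = 1 `^ t :> R by rewrite powR1.
by rewrite ge0_ler_powR ?nnegrE ?(ltW t0).
Qed.

End PathSums.

(** * The miss probability *)

Section DetectionBounds.
Context {R : realType} {M : nat}.
Variables (P : 'M[R]_M) (pi : 'rV[R]_M).
Hypotheses (hP : stochastic P) (hpi : stationary_distribution P pi).
Local Notation observation N := (N.-tuple (M.-tuple (measurableTypeR R))).

Definition path_mean (beta : R) N (s : {ffun 'I_N -> 'I_M}) (m : 'I_M) (n : 'I_N) : R :=
  if m == s n then beta else 0.

(** Each column has one entry of mean [beta], so the Gaussian factor is the same for all paths. *)
Lemma sum_path_mean beta N (s : {ffun 'I_N -> 'I_M}) :
  \sum_(n < N) \sum_(m < M) path_mean beta s m n ^+ 2 = N%:R * beta ^+ 2.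
Proof.
under eq_bigr => n _.
  rewrite (bigD1 (s n))//= /path_mean eqxx big1 ?addr0 => [|m /negbTE ->]; last by rewrite expr0n.
  over.
by rewrite sumr_const card_ord mulr_natl.
Qed.

Lemma miss_prob_integral beta N (D : set (observation N.+1)) : measurable D ->
  (miss_prob P pi beta D = \int[law_H0 N.+1]_(y in ~` D)
    (\sum_(s : {ffun 'I_N.+1 -> 'I_M}) path_prob P pi s * likelihood (path_mean beta s) y)%:E)%E.
Proof.
move=> mD; have mDC := measurableC mD.
have mL (s : {ffun 'I_N.+1 -> 'I_M}) :
    measurable_fun (~` D) (fun y => (likelihood (path_mean beta s) y)%:E).
  by apply: measurable_funTS; apply/measurable_EFinP; exact: measurable_likelihood.
under [RHS]eq_integral do rewrite -sumEFin.
rewrite ge0_integral_sum//; last 2 first.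
- move=> s; under eq_fun do rewrite EFinM.
  by apply: emeasurable_funM.
- move=> s y _; rewrite lee_fin; apply: mulr_ge0; first exact: path_prob_ge0.
  exact/ltW/likelihood_gt0.
rewrite /miss_prob /law_H1; apply: eq_bigr => s _.
under [RHS]eq_integral do rewrite EFinM.
rewrite ge0_integralZl ?lee_fin ?(path_prob_ge0 hP hpi)//; last first.
  by move=> y _; rewrite lee_fin ltW// likelihood_gt0.
congr (_ * _)%E.
exact: (has_density_measureE (gaussian_law_density (path_mean beta s)) mDC).
Qed.

(* The detector thresholds [Z = \sum_s (P(s) * L_s) `^ t], which dominates the
   likelihood ratio raised to the power [t]; Markov's inequality for [Z] under H0
   gives the threshold that achieves the false alarm level. *)
Lemma detector_ex (beta t eps K : R) N : 0 < t <= 1 -> 0 < eps -> 0 < K ->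
  \sum_(s : {ffun 'I_N.+1 -> 'I_M}) path_prob P pi s `^ t <= K ->
  exists D : set (observation N.+1), [/\ measurable D,
    (law_H0 N.+1 D <= eps%:E)%E &
    (miss_prob P pi beta D <=
      ((K * expR ((t ^+ 2 - t) / 2 * (N.+1%:R * beta ^+ 2)) / eps) `^ t^-1)%:E)%E].
Proof.
move=> t01 eps0 K0 SK; have /andP[t0 _] := t01.
set tau := _ / eps.
have tau0 : 0 < tau by rewrite divr_gt0// mulr_gt0// expR_gt0.
pose x (s : {ffun 'I_N.+1 -> 'I_M}) y := path_prob P pi s * likelihood (path_mean beta s) y.
have x0 s y : 0 <= x s y.
  by rewrite mulr_ge0 ?(path_prob_ge0 hP hpi)// ltW// likelihood_gt0.
pose Z (y : observation N.+1) := \sum_s x s y `^ t.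
have Z0 y : 0 <= Z y by apply: sumr_ge0 => s _; exact: powR_ge0.
have xtE s y : x s y `^ t = path_prob P pi s `^ t * likelihood (path_mean beta s) y `^ t.
  by rewrite powRM ?(path_prob_ge0 hP hpi)// ltW// likelihood_gt0.
have mxt s : measurable_fun setT (fun y => x s y `^ t).
  under eq_fun do rewrite xtE; apply: measurable_funM => //.
  apply: (measurableT_comp (measurable_powR t)); exact: measurable_likelihood.
have mZ : measurable_fun setT Z by exact: measurable_sum.
have intZ : (\int[law_H0 N.+1]_y (Z y)%:E <= (tau * eps)%:E)%E.
  under eq_integral do rewrite -sumEFin.
  rewrite ge0_integral_sum//; last 2 first.
  - by move=> s; apply/measurable_EFinP.
  - by move=> s y _; rewrite lee_fin powR_ge0.
  rewrite (eq_bigr (fun s => (path_prob P pi s `^ t *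
      expR ((t ^+ 2 - t) / 2 * (N.+1%:R * beta ^+ 2)))%:E)) => [|s _].
    by rewrite sumEFin lee_fin -mulr_suml /tau divfK ?gt_eqF// ler_wpM2r// expR_ge0.
  under eq_integral do rewrite xtE EFinM.
  rewrite ge0_integralZl ?lee_fin ?powR_ge0//; last 2 first.
  - apply/measurable_EFinP; apply: (measurableT_comp (measurable_powR t)).
    exact: measurable_likelihood.
  - by move=> y _; rewrite lee_fin powR_ge0.
  by rewrite integral_likelihood_powR sum_path_mean.
pose D := [set y | tau < Z y].
have mD : measurable D.
  rewrite (_ : D = Z @^-1` `]tau, +oo[); last first.
    by apply/seteqP; split => y /=; rewrite in_itv/= andbT.
  by rewrite -[X in measurable X]setTI; exact: mZ.
exists D; split=> //.
- rewrite -(@lee_pmul2l _ tau%:E) ?lte_fin// -EFinM.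
  apply: le_trans intZ; rewrite -integral_cst//.
  apply: (@le_trans _ _ (\int[law_H0 N.+1]_(y in D) (Z y)%:E)%E).
    apply: ge0_le_integral => //.
    + by move=> y _; rewrite lee_fin ltW.
    + by apply: measurable_funTS; apply/measurable_EFinP.
    + by move=> y Dy; rewrite lee_fin ltW.
  apply: ge0_subset_integral => //; first exact/measurable_EFinP.
  by move=> y _; rewrite lee_fin.
- rewrite miss_prob_integral//.
  (* Off [D] the likelihood ratio is at most the power [t^-1] of [Z], hence of [tau]. *)
  apply: (@le_trans _ _ (\int[law_H0 N.+1]_(y in ~` D) (tau `^ t^-1)%:E)%E).
    apply: ge0_le_integral => //.
    + exact: measurableC.
    + by move=> y _; rewrite lee_fin; apply: sumr_ge0 => s _; exact: x0.
    + apply: measurable_funTS; apply/measurable_EFinP; apply: measurable_sum => s.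
      by apply: measurable_funM => //; exact: measurable_likelihood.
    + move=> y /negP; rewrite -leNgt => Zy; rewrite lee_fin.
      apply: le_trans (sumr_le_powR_sum t01 (x0^~ y)) _.
      by rewrite -/(Z y) ge0_ler_powR ?invr_ge0 ?nnegrE ?(ltW t0) ?(ltW tau0) ?Z0.
  rewrite integral_cst; last exact: measurableC.
  rewrite -[leRHS]mule1 lee_pmul2l ?lte_fin ?powR_gt0//.
  by apply: probability_le1; exact: measurableC.
Qed.

Lemma sum_path_prob N : \sum_(s : {ffun 'I_N.+1 -> 'I_M}) path_prob P pi s = 1.
Proof.
have [_ pi1 piP] := hpi.
transitivity ((pi *m P ^+ N *m (const_mx 1 : 'cV[R]_M)) 0 0).
  by rewrite -sum_paths; apply: eq_bigr => s _; rewrite mxE mulr1.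
have -> : pi *m P ^+ N = pi by rewrite (mulmx_expmx_eigen N (r := 1)) ?expr1n ?scale1r.
by rewrite mxE -[RHS]pi1; apply: eq_bigr => i _; rewrite mxE mulr1.
Qed.

(* Without this, the convention [ln 0 = 0] would give exponent 0 to a detector that
   never misses. *)
Lemma miss_prob_gt0 beta eps N (D : set (observation N.+1)) :
  measurable D -> (law_H0 N.+1 D <= eps%:E)%E -> eps < 1 ->
  (0 < miss_prob P pi beta D)%E.
Proof.
move=> mD De eps1.
have term_ge0 (s : {ffun 'I_N.+1 -> 'I_M}) :
    (0 <= (path_prob P pi s)%:E * gaussian_law (path_mean beta s) (~` D))%E.
  by rewrite mule_ge0// lee_fin (path_prob_ge0 hP hpi).
rewrite lt0e; apply/andP; split; last by apply: sume_ge0 => s _; exact: term_ge0.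
apply/negP => /eqP miss0.
(* For a path of positive probability, a zero miss probability makes the complement of [D] null
   under its Gaussian law, hence under H0, so [D] would have false alarm probability 1. *)
have [s s0] : exists s : {ffun 'I_N.+1 -> 'I_M}, 0 < path_prob P pi s.
  apply: contrapT => /forallNP sle; have := sum_path_prob N; apply/eqP.
  rewrite lt_eqF// (le_lt_trans _ ltr01)//; apply: sumr_le0 => s _.
  by rewrite leNgt; apply/negP.
have Gs0 : gaussian_law (path_mean beta s) (~` D) = 0%E.
  have : ((path_prob P pi s)%:E * gaussian_law (path_mean beta s) (~` D) <= 0)%E.
    rewrite -[leRHS]miss0 /miss_prob /law_H1 (bigD1 s)//= leeDl// sume_ge0//.
  rewrite -[leRHS](mule0 (path_prob P pi s)%:E) lee_pmul2l ?lte_fin// => Gle.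
  by apply/eqP; rewrite eq_le Gle measure_ge0.
have H0 : law_H0 N.+1 (~` D) = 0%E.
  exact: (has_density_null (gaussian_law_density (path_mean beta s))
    (likelihood_gt0 (path_mean beta s)) (measurableC mD) Gs0).
have H0C : law_H0 N.+1 (~` D) = (1 - law_H0 N.+1 D)%E by exact: probability_setC.
have : (0 < 1 - law_H0 N.+1 D)%E by rewrite sube_gt0 (le_lt_trans De)// lte_fin.
by rewrite -H0C H0 ltxx.
Qed.

End DetectionBounds.

(** * The error exponent *)

Section ErrorExponent.
Context {R : realType} {M : nat}.
Variables (P : 'M[R]_M) (pi : 'rV[R]_M).
Hypotheses (hP : stochastic P) (irrP : irreducible_chain P).
Hypothesis hpi : stationary_distribution P pi.

(** By optimality, [delta N] misses no more often than the detector of [detector_ex] at [t], whose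
    bound is controlled by the growth of the path sum; then take logarithms and let [N] tend to
    infinity. *)
Lemma error_exponent_ge (beta eps eta t : R)
    (delta : forall N : nat, set (N.+1.-tuple (M.-tuple (measurableTypeR R)))) :
  0 < t <= 1 -> 0 < eps < 1 ->
  (forall N, optimal_detector P pi beta eps (delta N)) ->
  error_exponent P pi beta delta eta ->
  (1 - t) * (beta ^+ 2 / 2) - log_lambda P t / t <= eta.
Proof.
move=> t01 /andP[eps0 eps1] opt deltaeta; have /andP[t0 _] := t01.
have [C C0 SC] := path_prob_powR_le hP irrP hpi t0.
have lam0 : 0 < lam P t by apply: lam_gt0 => //; exact: stationary_size_gt0 hpi.
pose L := log_lambda P t; pose k := (t ^+ 2 - t) / 2 * beta ^+ 2.
(* Minus the logarithm of the bound, divided by [N.+1]. The [- L] beside [ln C] accounts for having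
   [N] transitions among [N.+1] observations. *)
pose v N : R := - (t^-1 * ((ln C - ln eps - L) * harmonic N + (L + k))).
have v_cvg : v N @[N --> \oo] --> (1 - t) * (beta ^+ 2 / 2) - L / t.
  have -> : (1 - t) * (beta ^+ 2 / 2) - L / t =
      - (t^-1 * ((ln C - ln eps - L) * 0 + (L + k))).
    by rewrite /k; field; rewrite gt_eqF.
  apply: cvgN; apply: cvgM; first exact: cvg_cst.
  apply: cvgD; last exact: cvg_cst.
  by apply: cvgM; [exact: cvg_cst|exact: cvg_harmonic].
apply: (ler_cvg_to v_cvg deltaeta); apply: nearW => N /=.
have [mD De Dopt] := opt N.
have lamN0 : 0 < lam P t ^+ N by rewrite exprn_gt0.
have K0 : 0 < C * lam P t ^+ N by rewrite mulr_gt0.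
have [D' [mD' D'e missD']] := detector_ex hP hpi beta t01 eps0 K0 (SC N).
have := le_trans (Dopt D' mD' D'e) missD'.
have := miss_prob_gt0 hP hpi beta mD De eps1.
move: (miss_prob P pi beta (delta N)) => miss.
case: miss => [m| |]; rewrite ?lte_fin ?lee_fin//= => m0 mle.
rewrite lerNl opprK.
have : ln m <= t^-1 * (ln C + L *+ N + k * N.+1%:R - ln eps).
  apply: le_trans (_ : ln _ <= _).
    by rewrite ler_ln ?posrE; [exact: mle|exact: m0|rewrite (lt_le_trans m0)].
  rewrite ln_powR ln_div ?posrE ?mulr_gt0 ?expR_gt0//.
  rewrite !lnM ?posrE ?mulr_gt0 ?expR_gt0 ?exprn_gt0// expRK lnXn//.
  have -> : (t ^+ 2 - t) / 2 * (N.+1%:R * beta ^+ 2) = k * N.+1%:R by rewrite /k; ring.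
  exact: lexx.
move=> lnm; rewrite ler_pdivrMr ?ltr0n//; apply: le_trans lnm _.
rewrite -[leRHS]mulrA ler_pM2l ?invr_gt0//.
have hN : harmonic N * N.+1%:R = 1 :> R by rewrite /harmonic /= mulVf.
rewrite mulrDl -[X in _ <= X + _]mulrA hN mulr1 -mulr_natr -natr1 le_eqVlt.
by apply/orP; left; apply/eqP; ring.
Qed.

End ErrorExponent.

(** * The function [chi] and the bound on the exponent *)

Theorem proposition7 (R : realType) (M : nat) (P : 'M[R]_M) (pi : 'rV[R]_M)
    (hP : stochastic P) (hirr : irreducible_chain P) (haper : aperiodic_chain P)
    (hpi : stationary_distribution P pi) :
  (forall t : R, 0 < t <= 1 ->
     derivable (log_lambda P) t 1 /\
     forall a b : 'cV[R]_M,
       left_perron_vector (tilted P t) a -> right_perron_vector (tilted P t) b ->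
       rho P t = (a^T *m map2_mx *%R (log_mx P) (tilted P t) *m b) 0 0 /
                 (a^T *m tilted P t *m b) 0 0) /\
  exists chi : R -> R,
    [/\ forall t : R, 0 < t <= 1 -> chi (beta_param P t) = chi_param P t,
        (1 < M)%N ->
          [set beta_param P t | t in [set t : R | 0 < t <= 1]] =
          [set x : R | Num.sqrt (2 * entropy_rate P pi) <= x] &
        forall (beta eps eta : R)
          (delta : forall N : nat, set (N.+1.-tuple (M.-tuple (measurableTypeR R)))),
          0 < beta -> 0 < eps < 1 ->
          (forall N : nat, optimal_detector P pi beta eps (delta N)) ->
          error_exponent P pi beta delta eta ->
          (beta <= Num.sqrt (2 * entropy_rate P pi) -> 0 <= eta) /\
          (Num.sqrt (2 * entropy_rate P pi) <= beta -> chi beta <= eta)].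
Proof.
have M0 := stationary_size_gt0 hpi.
have H0 := entropy_rate_ge0 hP hpi.
have dL := is_derive_rho hP hirr hpi.
have tangentL := log_lambda_subgradient hP hirr hpi.
have L1 := log_lambda1 hP hirr hpi.
have r1 := rho1 hP hirr hpi.
split.
  move=> t _; split=> [|a b [a0 aA] [b0 Ab]]; first exact: (@ex_derive _ _ _ _ _ _ _ (dL t)).
  by apply: (rhoE hP hirr hpi) => // i; rewrite mxE.
(* [T x] collects the parameters at which [beta_param] equals [x]; [chi] picks one of them, and
   [chi_beta_inj] makes the choice immaterial. *)
pose T x := [set t : R | 0 < t <= 1 /\ beta_param P t = x].
have chi1 : chi_param P 1 = 0.
  by rewrite /chi_param L1 subrr !(mulr0, mul0r) subrr.
have one01 : 0 < (1 : R) <= 1 by rewrite ltr01 lexx.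
(* The default [t = 1] gives the value 0; at positive arguments it is only used
   when [M = 1]. *)
exists (fun x => chi_param P (xget 1 (T x))); split.
- move=> t t01.
  have [xt xtb] : T (beta_param P t) (xget 1 (T (beta_param P t))).
    by apply: xgetPex; exists t.
  exact: (chi_beta_inj dL tangentL L1 r1 H0).
- move=> M1; apply/seteqP; split=> x /=.
    by move=> [t t01 <-]; exact: (beta_ge tangentL L1 r1).
  have Hgt0 := entropy_rate_gt0 hP hirr hpi haper M1.
  move=> /(beta_surj dL tangentL L1 r1 H0 Hgt0)[t t01 tx].
  by exists t.
- move=> beta eps eta delta beta0 eps01 opt deltaeta.
  have bound t : 0 < t <= 1 -> _ := fun t01 => error_exponent_ge hP hirr hpi t01 eps01 opt deltaeta.
  (* The bound at [t = 1] is 0, because [log_lambda P 1 = 0]. *)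
  have eta0 : 0 <= eta.
    by apply: le_trans (bound 1 one01); rewrite L1 subrr !mul0r subrr.
  split=> // _.
  (* At a parameter [t] of [beta] the bound is exactly [chi_param P t], by [chiE]. *)
  case: xgetP => [t _ [t01 tb]|_]; last by rewrite chi1.
  apply: le_trans (bound t t01).
  by rewrite -tb -[chi_param P t]/(legendre_chi (log_lambda P) (rho P) t) (chiE tangentL L1 r1 H0 t01).
Qed.
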